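(* Let $G$ be a graph, and let $r,k\in\mathbb{Z}$ with $r\geq 1$ and $k\geq -1$. If $\mathrm{Hom}(C_{2r+1},G)$ is $k$-connected, then $\chi(G)\geq k+4$.
   Context: Graphs are undirected: a graph $G$ has a vertex set $V(G)$ and a symmetric edge relation $E(G)\subseteq V(G)\times V(G)$ (loops allowed). The chromatic number $\chi(G)$ is the minimal number of colors in an assignment of colors to the vertices such that no two vertices connected by an edge get the same color. For graphs $G$ and $H$, $\mathrm{Hom}(G,H)$ is the polyhedral complex whose cells are indexed by all functions $\eta:V(G)\to 2^{V(H)}\setminus\{\emptyset\}$ such that whenever $(x,y)\in E(G)$, $\tilde x\in\eta(x)$ and $\tilde y\in\eta(y)$, we have $(\tilde x,\tilde y)\in E(H)$. The cell $\eta$ is the direct product over $v\in V(G)$ of the simplices with vertex sets $\eta(v)$, and its closure consists of all cells $\tilde\eta$ with $\tilde\eta(v)\subseteq\eta(v)$ for all $v\in V(G)$. Equivalently (via barycentric subdivision), as a topological space $\mathrm{Hom}(G,H)$ is the geometric realization of the poset of all such $\eta$, ordered by $\eta\geq\tilde\eta$ iff $\eta(v)\supseteq\tilde\eta(v)$ for all $v$. $C_{2r+1}$ is the cycle with $V(C_{2r+1})=\mathbb{Z}_{2r+1}$ and $E(C_{2r+1})=\{(x,x+1),(x+1,x)\mid x\in\mathbb{Z}_{2r+1}\}$. A space is $(-1)$-connected iff it is non-empty; for $k\ge 0$ it is $k$-connected iff it is non-empty and its homotopy groups (sets) $\pi_i$ are trivial for $0\le i\leq k$. *)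

(* Defs.v *)
From HB Require Import structures.
From mathcomp Require Import all_boot all_order all_algebra.
From mathcomp Require Import all_classical all_reals all_analysis.
Import Order.TTheory GRing.Theory Num.Theory.
Import numFieldNormedType.Exports.

Set Implicit Arguments.
Unset Strict Implicit.
Unset Printing Implicit Defensive.

Local Open Scope classical_set_scope.
Local Open Scope ring_scope.

(* Loops and infinite vertex sets are allowed. *)
Record graph := Graph {
  vertex :> Type;
  edge : vertex -> vertex -> Prop;
  edge_sym : forall x y, edge x y -> edge y x
}.

Definition colorable (G : graph) (n : nat) : Prop :=
  exists c : G -> 'I_n, forall x y, edge x y -> c x != c y.

(* +oo when G has no finite coloring (in particular when G has a loop). *)
Definition chromatic_number (R : realType) (G : graph) : \bar R :=
  ereal_inf [set (n%:R)%:E | n in [set n | colorable G n]].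

Definition cycle_edge (r : nat) (x y : 'Z_(2 * r + 1)) : Prop :=
  y = x + 1 \/ x = y + 1.

Lemma cycle_edge_sym r (x y : 'Z_(2 * r + 1)) :
  cycle_edge x y -> cycle_edge y x.
Proof. by case=> ->; [right | left]. Qed.

(* The odd cycle C_(2r+1); only meaningful for r >= 1, since 'Z_1 is Z/2. *)
Definition odd_cycle (r : nat) : graph := Graph (@cycle_edge_sym r).

Record hom_cell (G H : graph) := HomCell {
  cell_fun :> G -> set H;
  cell_neq0 : forall x, cell_fun x !=set0;
  cell_edge : forall x y, edge x y ->
    forall x' y', cell_fun x x' -> cell_fun y y' -> edge x' y'
}.

Section hom_cell_order.
Variables G H : graph.
Implicit Types a b : hom_cell G H.

Lemma hom_cell_inj a b : cell_fun a = cell_fun b -> a = b.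
Proof.
case: a b => [f f0 fe] [g g0 ge] /= fg; subst g.
by congr HomCell; exact: Prop_irrelevance.
Qed.

HB.instance Definition _ := gen_eqMixin (hom_cell G H).
HB.instance Definition _ := gen_choiceMixin (hom_cell G H).

Definition hom_cell_le a b : bool := `[< forall x, a x `<=` b x >].

Fact hom_cell_le_refl : reflexive hom_cell_le.
Proof. by move=> a; apply/asboolP => x. Qed.

Fact hom_cell_le_anti : antisymmetric hom_cell_le.
Proof.
move=> a b /andP[/asboolP ab /asboolP ba]; apply: hom_cell_inj.
by apply/funext => x; apply/seteqP; split.
Qed.

Fact hom_cell_le_trans : transitive hom_cell_le.
Proof.
move=> b a c /asboolP ab /asboolP bc; apply/asboolP => x.
exact: subset_trans (ab x) (bc x).
Qed.

Fact hom_cell_display : Order.disp_t. Proof. exact: Order.Disp tt tt. Qed.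

HB.instance Definition _ := Order.Le_isPOrder.Build hom_cell_display
  (hom_cell G H) hom_cell_le_refl hom_cell_le_anti hom_cell_le_trans.

End hom_cell_order.

Definition finite_chain d (P : porderType d) (C : set P) : Prop :=
  finite_set C /\ forall x y, C x -> C y -> (x >=< y)%O.

(* Points of the order complex of P, in barycentric coordinates. *)
Record realization (R : realType) d (P : porderType d) := Realization {
  coord :> P -> R;
  coord_ge0 : forall x, 0 <= coord x;
  coord_chain : finite_chain [set x | coord x != 0];
  coord_sum : \sum_(x \in [set: P]) coord x = 1
}.

Section realization_topology.
Variables (R : realType) (d : Order.disp_t) (P : porderType d).
Local Notation X := (realization R P).

Definition closed_simplex (C : set P) : set X :=
  [set w : X | [set x | w x != 0] `<=` C].

(* The weak topology: U is open iff its trace on every closed simplex is open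
   for the sup metric on barycentric coordinates, which induces the Euclidean
   topology there since C is finite. *)
Definition realization_open (U : set X) : Prop :=
  forall C, finite_chain C -> forall w, closed_simplex C w -> U w ->
  exists2 e : R, 0 < e & forall w', closed_simplex C w' ->
    (forall x, `|w x - w' x| < e) -> U w'.

Fact realization_openT : realization_open setT.
Proof. by move=> C _ w _ _; exists 1. Qed.

Fact realization_openI : setI_closed realization_open.
Proof.
move=> U V oU oV C cC w Cw [Uw Vw].
have [e e0 eU] := oU C cC w Cw Uw; have [f f0 fV] := oV C cC w Cw Vw.
exists (Num.min e f) => [|w' Cw' ww']; first by rewrite lt_min e0 f0.
by split; [apply: eU | apply: fV] => // x;
  have := ww' x; rewrite lt_min => /andP[].
Qed.

Fact realization_open_bigU (I : Type) (f : I -> set X) :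
  (forall i, realization_open (f i)) -> realization_open (\bigcup_i f i).
Proof.
move=> of_ C cC w Cw [i _ fiw]; have [e e0 ef] := of_ i C cC w Cw fiw.
by exists e => // w' Cw' ww'; exists i => //; exact: ef.
Qed.

HB.instance Definition _ := gen_eqMixin X.
HB.instance Definition _ := gen_choiceMixin X.
HB.instance Definition _ := isOpenTopological.Build X
  realization_openT realization_openI realization_open_bigU.

End realization_topology.

Definition Hom_complex (R : realType) (G H : graph) : topologicalType :=
  realization R (hom_cell G H).

Section homotopy_groups.
Variables (R : realType) (X : topologicalType).

Definition cube n : set 'rV[R]_n := [set t | forall j, 0 <= t 0 j <= 1].

Definition cube_boundary n : set 'rV[R]_n :=
  [set t | cube t /\ exists j, t 0 j = 0 \/ t 0 j = 1].

(* Maps (I^n, dI^n) -> (X, x0), as total functions whose values outside of the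
   cube are irrelevant. For n = 0 the cube is a point with empty boundary. *)
Definition spheroid n (x0 : X) : set ('rV[R]_n -> X) :=
  [set f | {within @cube n, continuous f} /\
           forall t, cube_boundary t -> f t = x0].

Definition rel_homotopic n (x0 : X) (f g : 'rV[R]_n -> X) : Prop :=
  exists F : R * 'rV[R]_n -> X,
    [/\ {within `[0, 1] `*` @cube n, continuous F},
        forall t, cube t -> F (0, t) = f t,
        forall t, cube t -> F (1, t) = g t &
        forall s t, s \in `[0, 1] -> cube_boundary t -> F (s, t) = x0].

Definition homotopy_class n (x0 : X) (f : 'rV[R]_n -> X) :
    set ('rV[R]_n -> X) :=
  [set g | spheroid x0 g /\ rel_homotopic x0 f g].

(* The underlying pointed set of pi_n(X, x0); its base point, which is the
   neutral element when n > 0, is the class of the constant map. *)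
Definition homotopy_group n (x0 : X) : set (set ('rV[R]_n -> X)) :=
  [set homotopy_class x0 f | f in spheroid x0].

Definition trivial_homotopy_group n (x0 : X) : Prop :=
  @homotopy_group n x0 = [set homotopy_class x0 (cst x0)].

Definition k_connected (k : int) : Prop :=
  [set: X] !=set0 /\
  forall (i : nat) (x0 : X), i%:Z <= k -> trivial_homotopy_group i x0.

End homotopy_groups.

(* Main.v *)
(* Suppose G has a proper colouring with m + 2 colours, where m <= k + 1.
   Let X = Hom(C_(2r+1), G), let gamma be the involution of X induced by the
   reflection i -> - i of the cycle, and let A_i : X -> R^(m+2) be the
   distribution of colours at the vertex i. Adjacent distributions have
   disjoint supports, so A_i - A_j is a nowhere vanishing map to a hyperplane
   when i and j are adjacent, i.e. a map to the sphere S^m. The reflection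
   exchanges r and r + 1, so A_r - A_(r+1) is odd, while it fixes 0 and
   exchanges 1 and -1, so A_0 - (A_1 + A_(-1)) / 2 is even. Moving one of the
   two vertices at a time along the cycle makes the odd map and the even map
   homotopic up to sign. By connectivity there is an equivariant map S^m -> X,
   built one hemisphere at a time; composing gives an odd self-map of S^m
   homotopic to an even one, which is absurd since the first has odd degree
   and the second has even degree. The parity of the degree is handled
   combinatorially, by a variant of Fan's lemma for labellings of the Kuhn
   triangulation of a fine cubical grid. *)
From HB Require Import structures.
Require Import Defs.
From mathcomp Require Import all_boot all_order all_algebra finmap.
From mathcomp Require Import all_classical all_reals all_analysis.
From mathcomp Require Import zify lra ring.
Import Order.TTheory GRing.Theory Num.Theory.
Import numFieldNormedType.Exports.

Set Implicit Arguments.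
Unset Strict Implicit.
Unset Printing Implicit Defensive.

(** * Fan's lemma on the Kuhn triangulation of a grid *)

Notation "\xor_ ( i <- r ) F" := (\big[addb/false]_(i <- r) F)
  (at level 41, F at level 41, i, r at level 50).
Notation "\xor_ ( i < n ) F" := (\big[addb/false]_(i < n) F)
  (at level 41, F at level 41, i, n at level 50).

(** Applied to the vertices of a simplex, this lists its facets, one for each position. *)
Fixpoint dels (T : Type) (l : seq T) : seq (seq T) :=
  if l is x :: l' then l' :: map (cons x) (dels l') else [::].

Section Deletions.
Variable T : eqType.
Implicit Types (l v : seq T).

(** [rem] deletes the first occurrence of an entry, possibly not the one at the given position, but
    the two results are permutations of each other. *)
Lemma big_dels_rem (F : seq T -> bool) l :
  (forall v w, perm_eq v w -> F v = F w) ->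
  \xor_(v <- dels l) F v = \xor_(x <- l) F (rem x l).
Proof.
move=> Fp; suff H p : \xor_(v <- dels l) F (p ++ v) =
    \xor_(x <- l) F (rem x (p ++ l)) by exact: (H [::]).
elim: l p => [|y l IH] p /=; first by rewrite !big_nil.
rewrite !big_cons big_map; congr addb.
  apply: Fp; rewrite -(perm_cons y); apply: perm_trans (perm_to_rem _).
    by rewrite -cat1s perm_catCA.
  by rewrite mem_cat mem_head orbT.
have := IH (rcons p y); rewrite cat_rcons => <-.
by apply: eq_bigr => v _; rewrite cat_rcons.
Qed.

Lemma big_dels_perm (F : seq T -> bool) l l' :
  (forall v w, perm_eq v w -> F v = F w) -> perm_eq l l' ->
  \xor_(v <- dels l) F v = \xor_(v <- dels l') F v.
Proof.
move=> Fp ll'; rewrite !big_dels_rem // (perm_big _ ll') /=.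
rewrite big_seq [RHS]big_seq; apply: eq_bigr => x xl'; apply: Fp.
rewrite -(perm_cons x) -(permPr (perm_to_rem xl')) -(permPr ll') perm_sym.
by apply: perm_to_rem; rewrite (perm_mem ll').
Qed.

End Deletions.

Lemma map_dels (T U : Type) (f : T -> U) l :
  map (map f) (dels l) = dels (map f l).
Proof.
elim: l => //= x l IH; congr cons; rewrite -IH -!map_comp.
exact: eq_map.
Qed.

(** * Alternating labels *)

Section Alternation.

Fixpoint altw (b : bool) (u : seq bool) : bool :=
  if u is c :: u' then (c == b) && altw (~~ b) u' else true.

(** Let [u] be nonempty. If it alternates from [b], only deleting its last letter leaves a word
    alternating from [b]; if it alternates from [~~ b], only deleting its first letter does. In all
    other cases the successful deletions come in pairs: either one of two equal neighbours. *)
Lemma altw_dels b u :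
  \xor_(v <- dels u) altw b v = altw b u (+) altw (~~ b) u.
Proof.
elim: u b => [|c u IH] b /=; first by rewrite big_nil.
rewrite big_cons big_map /=.
have -> : \xor_(v <- dels u) ((c == b) && altw (~~ b) v) =
    (c == b) && \xor_(v <- dels u) altw (~~ b) v.
  by case: (c == b) => //=; rewrite big1.
rewrite IH negbK.
by case: c; case: b => /=; case: (altw true u); case: (altw false u).
Qed.

(* The label [(j, b)] stands for the nonzero integer [j + 1] if [b], and
   [- (j + 1)] otherwise. *)
Definition label := (nat * bool)%type.

Definition neg (x : label) : label := (x.1, ~~ x.2).

Definition lable (x y : label) :=
  (x.1 < y.1) || ((x.1 == y.1) && (x.2 ==> y.2)).

Lemma lable_total : total lable.
Proof.
move=> [x a] [y b]; rewrite /lable /=.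
by case: a; case: b => /=; lia.
Qed.

Lemma lable_trans : transitive lable.
Proof.
move=> [y b] [x a] [z c]; rewrite /lable /=.
by case: a; case: b; case: c => /=; lia.
Qed.

Lemma lable_anti : antisymmetric lable.
Proof.
move=> [x a] [y b]; rewrite /lable /= => xy.
have [-> ->] : x = y /\ a = b by case: a b xy => -[] /=; lia.
by [].
Qed.

(* For labels without opposite pairs: by increasing absolute value, the signs
   alternate, the first one being [b]. *)
Definition alt (b : bool) (l : seq label) := altw b (map snd (sort lable l)).

Lemma alt_perm b l l' : perm_eq l l' -> alt b l = alt b l'.
Proof.
move=> p; rewrite /alt; congr (altw b (map _ _)).
exact/(perm_sortP lable_total lable_trans lable_anti).
Qed.

Lemma alt_sorted b l : sorted lable l -> alt b l = altw b (map snd l).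
Proof. by move=> sl; rewrite /alt sorted_sort //; exact: lable_trans. Qed.

Lemma dels_subseq (T : eqType) (l v : seq T) : v \in dels l -> subseq v l.
Proof.
elim: l v => //= x l IH v; rewrite inE => /orP[/eqP->|/mapP[w wl ->]].
  exact: (subseq_cons l x).
by rewrite /= eqxx; exact: IH.
Qed.

(** This counts the alternating facets of a labelled simplex modulo 2. Deletion keeps a sorted list
    sorted, which reduces the claim to words of signs. *)
Lemma alt_dels b l :
  \xor_(v <- dels l) alt b v = alt b l (+) alt (~~ b) l.
Proof.
have ps : perm_eq l (sort lable l) by rewrite perm_sym perm_sort.
rewrite (big_dels_perm (F := alt b) _ ps); last exact: alt_perm.
have ss : sorted lable (sort lable l) by apply: sort_sorted; exact: lable_total.
rewrite {2}/alt {2}/alt -altw_dels -map_dels big_map big_seq [RHS]big_seq.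
apply: eq_bigr => v /dels_subseq vs; apply: alt_sorted.
exact: subseq_sorted lable_trans _ _ vs ss.
Qed.

(** The absence of complementary edges in Fan's lemma. *)
Definition nc (l : seq label) := forall x y, x \in l -> y \in l -> x <> neg y.

Lemma nc_eq l x y : nc l -> x \in l -> y \in l -> x.1 = y.1 -> x = y.
Proof.
case: x y => x a [y b] ncl xl yl /= e; subst y.
have := ncl _ _ xl yl; rewrite /neg /=.
by case: a {xl}; case: b {yl} => // H; case: H.
Qed.

(** Two labels of equal absolute value coincide by [nc], so after sorting they would be neighbours
    with the same sign. *)
Lemma alt_uniq b l : nc l -> alt b l -> uniq (map fst l).
Proof.
move=> ncl; have ps : perm_eq (sort lable l) l by rewrite perm_sort.
have ncs : nc (sort lable l).
  by move=> x y; rewrite !(perm_mem ps); exact: ncl.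
rewrite -(perm_uniq (perm_map _ ps)) /alt.
have : sorted lable (sort lable l) by apply: sort_sorted; exact: lable_total.
move: (sort lable l) ncs => s ncs ss al.
apply: (sorted_uniq ltn_trans ltnn).
case: s ncs ss al => //= x s; elim: s x b => //= y s IH x b ncs.
case/andP=> xy ys /and3P[/eqP xb /eqP yb al]; apply/andP; split; last first.
  apply: (IH y (~~ b)) => //; last by rewrite yb eqxx.
  by move=> u v us vs; apply: ncs; rewrite inE ?us ?vs orbT.
rewrite ltn_neqAle; apply/andP; split; last first.
  by move: xy; rewrite /lable => /orP[/ltnW//|/andP[/eqP->]].
apply/eqP => e; have E : x = y by apply: (nc_eq ncs); rewrite ?inE ?eqxx ?orbT.
by move: yb; rewrite -E xb; case: (b).
Qed.

(** Negation can reverse [lable] only between labels of equal absolute value, and these coincide by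
    [nc]; hence it commutes with sorting. *)
Lemma alt_neg b l : nc l -> alt b (map neg l) = alt (~~ b) l.
Proof.
move=> ncl; have ps : perm_eq (sort lable l) l by rewrite perm_sort.
have altwN u : altw b (map negb u) = altw (~~ b) u.
  by elim: u b => //= c u IH b'; rewrite IH; case: c; case: b'.
rewrite /alt -altwN.
have -> : map negb (map snd (sort lable l)) = map snd (map neg (sort lable l)).
  by rewrite -!map_comp.
congr (altw b (map _ _)).
apply: (sorted_eq lable_trans lable_anti).
- by apply: sort_sorted; exact: lable_total.
- have : sorted lable (sort lable l) by apply: sort_sorted; exact: lable_total.
  apply: (@homo_sorted_in _ _ (mem l)); last first.
    by apply/allP => x; rewrite (perm_mem ps).
  move=> x y xl yl; rewrite /lable /neg /=.
  case/orP=> [->//|/andP[/eqP e _]].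
  by rewrite (nc_eq ncl xl yl e) eqxx implybb orbT.
- by rewrite perm_sort perm_map // perm_sym.
Qed.

(** Pigeonhole on the distinct absolute values given by [alt_uniq]. *)
Lemma alt_bounded b d l :
  nc l -> (forall x, x \in l -> x.1 < d) -> d < size l -> alt b l = false.
Proof.
move=> ncl ld sl; apply/negP => /(alt_uniq ncl) u.
have : size (map fst l) <= size (iota 0 d).
  apply: uniq_leq_size => // i /mapP[x xl ->]; rewrite mem_iota /=; exact: ld.
by rewrite size_map size_iota leqNgt sl.
Qed.

End Alternation.

(** * Kuhn simplices and a Stokes formula modulo 2 *)

Section Kuhn.

(** Faces of all dimensions share this type: in dimension [d] the coordinates from [d] on are frozen
    parameters. *)
Definition pt := nat -> nat.
Implicit Types (z : pt) (s l : seq nat).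

HB.instance Definition _ := gen_eqMixin pt.

Definition upd z d k : pt := fun j => if j == d then k else z j.
Definition step z i : pt := upd z i (z i).+1.

Lemma updE z d k j : upd z d k j = if j == d then k else z j.
Proof. by []. Qed.

Lemma updU z d k k' : upd (upd z d k) d k' = upd z d k'.
Proof. by apply/funext => j; rewrite !updE; case: eqP. Qed.

Lemma upd_comm z d d' k k' :
  d != d' -> upd (upd z d k) d' k' = upd (upd z d' k') d k.
Proof.
move=> dd'; apply/funext => j; rewrite !updE.
by case: (eqVneq j d) => // ->; rewrite (negPf dd').
Qed.

Lemma stepE z i j : step z i j = z j + (j == i).
Proof. by rewrite /step updE; case: eqP => [->|]; rewrite ?addn1 ?addn0. Qed.

Lemma stepC z i j : step (step z i) j = step (step z j) i.
Proof. by apply/funext => k; rewrite !stepE addnAC. Qed.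

(* When [s] enumerates the coordinates, [chain z s] lists the vertices of a Kuhn
   simplex of the unit cube based at [z]. *)
Fixpoint chain z s : seq pt :=
  z :: if s is i :: s' then chain (step z i) s' else [::].

Lemma chain_cons z i s : chain z (i :: s) = z :: chain (step z i) s.
Proof. by []. Qed.

Lemma size_chain z s : size (chain z s) = (size s).+1.
Proof. by elim: s z => //= i s IH z; rewrite IH. Qed.

Lemma mem_chain z s v i : v \in chain z s -> z i <= v i <= z i + count_mem i s.
Proof.
elim: s z => [|j s IH] z /=; first by rewrite inE => /eqP->; rewrite addn0 leqnn.
rewrite inE => /orP[/eqP->|/IH]; first by rewrite leqnn leq_addr.
rewrite stepE (eq_sym i j).
by case: (j == i) => /=; rewrite ?addn0 ?addn1 => /andP[A B]; apply/andP; split; lia.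
Qed.

Lemma big_permutations l (f : seq nat -> bool) : uniq l -> l != [::] ->
  \xor_(s <- permutations l) f s =
  \xor_(i <- l) \xor_(s <- permutations (rem i l)) f (i :: s).
Proof.
move=> ul l0; have sl : 0 < size l by case: (l) l0.
rewrite (perm_big _ (permutationsE sl)) /= undup_id // big_allpairs_dep.
by [].
Qed.

Lemma big_offdiag l (f : nat -> nat -> bool) :
  uniq l -> (forall i j, f i j = f j i) ->
  \xor_(i <- l) \xor_(j <- rem i l) f i j = false.
Proof.
move=> + fC; elim: l => [|x l IH] /=; first by rewrite big_nil.
case/andP=> xl ul; rewrite big_cons eqxx.
have -> : \xor_(i <- l) \xor_(j <- (if x == i then l else x :: rem i l)) f i j
   = \xor_(i <- l) f x i (+) \xor_(i <- l) \xor_(j <- rem i l) f i j.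
  rewrite -big_split /= big_seq [RHS]big_seq; apply: eq_bigr => i il.
  have -> : (x == i) = false by apply/negP => /eqP xi; rewrite xi il in xl.
  by rewrite big_cons fC.
by rewrite addbA addbb IH.
Qed.

(* Swapping two consecutive directions changes neither the first nor the last
   vertex, so that the facets missing an intermediate vertex cancel in pairs. *)
Lemma chain_facets n l z (F : seq pt -> bool) : uniq l -> size l = n.+1 ->
  \xor_(s <- permutations l) \xor_(v <- dels (chain z s)) F v =
  \xor_(s <- permutations l)
    (F (behead (chain z s)) (+) F (take (size l) (chain z s))).
Proof.
elim: n l z F => [|n IH] l z F ul sl.
  case: l sl ul => [//|i []] //= _ _.
  by rewrite /permutations /= !big_seq1 /= !big_cons big_nil addbF.
have l0 : l != [::] by case: (l) sl.
rewrite !big_permutations //.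
have -> : \xor_(i <- l) \xor_(s <- permutations (rem i l))
     \xor_(v <- dels (chain z (i :: s))) F v =
   \xor_(i <- l) (\xor_(s <- permutations (rem i l)) F (chain (step z i) s) (+)
     \xor_(s <- permutations (rem i l))
      (F (z :: behead (chain (step z i) s)) (+)
       F (z :: take n.+1 (chain (step z i) s)))).
  rewrite big_seq [RHS]big_seq; apply: eq_bigr => i il.
  have si : size (rem i l) = n.+1 by rewrite size_rem // sl.
  rewrite -si -(IH (rem i l) (step z i) (fun v => F (z :: v))) ?rem_uniq //.
  by rewrite -big_split; apply: eq_bigr => s _ /=; rewrite big_cons big_map.
rewrite big_split /=.
under [X in _ (+) X]eq_bigr do rewrite big_split /=.
rewrite big_split /=.
(* These facets miss the second vertex. They depend symmetrically on the first two directions, so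
   they cancel by [big_offdiag]. *)
have -> : \xor_(i <- l) \xor_(s <- permutations (rem i l))
    F (z :: behead (chain (step z i) s)) = false.
  pose f i j := \xor_(s <- permutations (rem j (rem i l)))
    F (z :: chain (step (step z i) j) s).
  rewrite -[RHS](@big_offdiag l f) //; last first.
    move=> i j; rewrite /f stepC; congr (\xor_(s <- permutations _) _).
    by rewrite !(rem_filter _ ul) !rem_filter ?filter_uniq // -!filter_predI;
       apply: eq_filter => k /=; rewrite andbC.
  rewrite big_seq [RHS]big_seq; apply: eq_bigr => i il.
  rewrite big_permutations ?rem_uniq //.
  by rewrite -size_eq0 size_rem // sl.
rewrite addFb -big_split /=; apply: eq_bigr => i _.
by rewrite -big_split; apply: eq_bigr => s _ /=; rewrite sl.
Qed.

Lemma chain_rcons z s i :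
  chain z (rcons s i) = rcons (chain z s) (step (last z (chain z s)) i).
Proof. by elim: s z => [|j s IH] z //=; rewrite IH; case: s {IH}. Qed.

Lemma chain_boundary l z (F : seq pt -> bool) : uniq l -> l != [::] ->
  \xor_(s <- permutations l) \xor_(v <- dels (chain z s)) F v =
  \xor_(i <- l) \xor_(s <- permutations (rem i l))
    (F (chain (step z i) s) (+) F (chain z s)).
Proof.
move=> ul l0; case sl : (size l) => [|n]; first by case: (l) sl l0.
rewrite (chain_facets _ _ ul sl) big_split /=.
have -> : \xor_(s <- permutations l) F (take (size l) (chain z s)) =
    \xor_(s <- permutations l) F (chain z (behead s)).
  (* Rotation moves the first direction to the end, so that the facets missing the last vertex
     become chains from [z] along the remaining directions. *)
  have pr : perm_eq (permutations l) (map (rot 1) (permutations l)).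
    apply: uniq_perm; rewrite ?map_inj_uniq ?permutations_uniq //.
      exact: rot_inj.
    move=> s; rewrite mem_permutations; apply/idP/mapP => [sl'|[t tl ->]].
      exists (rotr 1 s); last by rewrite rotrK.
      by rewrite mem_permutations perm_rotr.
    by rewrite perm_rot -mem_permutations.
  rewrite (perm_big _ pr) /= big_map big_seq [RHS]big_seq.
  apply: eq_bigr => -[|i s]; rewrite mem_permutations => /perm_size ss.
    by rewrite sl in ss.
  by rewrite rot1_cons chain_rcons -ss /= -(size_chain z s) -cats1 take_size_cat.
rewrite -big_split /= big_permutations //.
Qed.

Variable N : nat.

(* Sum modulo 2 of [F] over the grid points whose first [d] coordinates are
   less than [N], the other ones being those of [z]. *)
Fixpoint box d (F : pt -> bool) z : bool :=
  if d is d'.+1 then \xor_(k < N) box d' F (upd z d' k) else F z.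

Lemma box_add d F G z : box d (fun z => F z (+) G z) z = box d F z (+) box d G z.
Proof.
by elim: d z => //= d IH z; rewrite -big_split /=; apply: eq_bigr => k _.
Qed.

Lemma box_false d z : box d (fun=> false) z = false.
Proof. by elim: d z => //= d IH z; rewrite big1. Qed.

Lemma box_sum d (T : eqType) (r : seq T) F z :
  box d (fun z => \xor_(t <- r) F t z) z = \xor_(t <- r) box d (F t) z.
Proof.
elim: d z => //= d IH z; rewrite exchange_big /=.
by apply: eq_bigr => k _.
Qed.

Definition bounded z := forall i, z i <= N.

Lemma bounded_upd z d k : bounded z -> k <= N -> bounded (upd z d k).
Proof. by move=> bz kN i; rewrite updE; case: eqP. Qed.

Lemma eq_box d F G z : bounded z ->
  (forall z', bounded z' -> (forall i, i < d -> z' i < N) ->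
    (forall i, d <= i -> z' i = z i) -> F z' = G z') ->
  box d F z = box d G z.
Proof.
elim: d z => [|d IH] z bz FG /=; first exact: FG.
apply: eq_bigr => k _; apply: IH => [|z' bz' z'N z'z].
  by apply: bounded_upd => //; exact: ltnW.
have z'd : z' d = k by rewrite z'z // updE eqxx.
apply: FG => // i id'.
  by move: id'; rewrite ltnS leq_eqVlt => /orP[/eqP->|/z'N//]; rewrite z'd.
by rewrite z'z ?updE; [case: eqP => // E; lia | lia].
Qed.

Lemma box_upd d e F z k : d <= e ->
  box d (fun z => F (upd z e k)) z = box d F (upd z e k).
Proof.
elim: d z => //= d IH z de; apply: eq_bigr => j _.
by rewrite IH ?(ltnW de) // upd_comm // ltn_eqF.
Qed.

Lemma box_step d i F z : d <= i ->
  box d (fun z => F (step z i)) z = box d F (step z i).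
Proof.
elim: d z => //= d IH z de; apply: eq_bigr => j _.
rewrite IH ?(ltnW de) // /step upd_comm ?ltn_eqF //.
by rewrite updE gtn_eqF.
Qed.

Lemma xor_telescope n (f : nat -> bool) :
  \xor_(k < n) (f k.+1 (+) f k) = f n (+) f 0.
Proof.
elim: n => [|n IH]; first by rewrite big_ord0 addbb.
by rewrite big_ord_recr /= IH; case: (f n.+1); case: (f n); case: (f 0).
Qed.

Lemma box_last d F z :
  box d.+1 (fun z => F (step z d) (+) F z) z =
  box d F (upd z d N) (+) box d F (upd z d 0).
Proof.
rewrite -(xor_telescope N (fun k => box d F (upd z d k))) /=.
apply: eq_bigr => k _; rewrite box_add box_step //.
by rewrite /step updU updE eqxx.
Qed.

(** The sum in direction [i] telescopes to the two opposite faces, where [F] vanishes. *)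
Lemma box_side d i F z : i < d -> bounded z ->
  (forall z', bounded z' -> (forall j, j < d -> j != i -> z' j < N) ->
    z' i = 0 \/ z' i = N -> F z' = false) ->
  box d (fun z => F (step z i) (+) F z) z = false.
Proof.
elim: d z F => // d IH z F; rewrite ltnS leq_eqVlt => /orP[/eqP->|id'] bz F0.
  have H k : k <= N -> k = 0 \/ k = N -> box d F (upd z d k) = false.
    move=> kN k0N; rewrite -(box_false d (upd z d k)).
    apply: eq_box => [|z' bz' z'N z'z]; first exact: bounded_upd.
    apply: F0 => // [j|]; last by rewrite z'z // updE eqxx.
    by rewrite ltnS leq_eqVlt => /orP[->//|/z'N].
  by rewrite box_last !H; auto.
rewrite /= big1 // => k _.
have bk : bounded (upd z d k) by apply: bounded_upd => //; exact: ltnW.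
(* The induction hypothesis knows nothing about coordinate [d], so the bound on it is built into the
   function. *)
pose F' z' := (z' d < N) && F z'.
rewrite -(IH (upd z d k) F') //.
  apply: eq_box => // z' _ _ z'z; rewrite /F' stepE (gtn_eqF id') addn0.
  by rewrite z'z // updE eqxx ltn_ord.
move=> z' bz' z'N z'0; rewrite /F'; case: ltnP => //= z'd.
apply: F0 => // j; rewrite ltnS leq_eqVlt => /orP[/eqP->//|jd ji].
exact: z'N.
Qed.

(** The sum modulo 2 over the top-dimensional simplices of the Kuhn triangulation of a cube of side
    [N]. *)
Definition total d (F : seq pt -> bool) z : bool :=
  \xor_(s <- permutations (iota 0 d)) box d (fun z => F (chain z s)) z.

Lemma eq_total d F G z : bounded z ->
  (forall z' s, bounded z' -> (forall i, i < d -> z' i < N) ->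
    (forall i, d <= i -> z' i = z i) -> perm_eq s (iota 0 d) ->
    F (chain z' s) = G (chain z' s)) ->
  total d F z = total d G z.
Proof.
move=> bz FG; rewrite /total big_seq [RHS]big_seq; apply: eq_bigr => s.
by rewrite mem_permutations => sd; apply: eq_box => // z' *; exact: FG.
Qed.

Lemma total_add d F G z :
  total d (fun v => F v (+) G v) z = total d F z (+) total d G z.
Proof.
by rewrite /total -big_split /=; apply: eq_bigr => s _; rewrite box_add.
Qed.

Lemma total_false d z : total d (fun=> false) z = false.
Proof.
by rewrite /total big1 // => s _; rewrite box_false.
Qed.

(* The hypothesis says that [F] vanishes on the lateral faces; the remaining
   boundary consists of the top and bottom faces. *)
Lemma stokes d F z : bounded z ->
  (forall i s z', i < d -> perm_eq s (rem i (iota 0 d.+1)) -> bounded z' ->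
    (forall j, j < d.+1 -> j != i -> z' j < N) -> z' i = 0 \/ z' i = N ->
    F (chain z' s) = false) ->
  total d.+1 (fun c => \xor_(v <- dels c) F v) z =
  total d F (upd z d N) (+) total d F (upd z d 0).
Proof.
move=> bz F0; rewrite /total -box_sum.
under eq_fun do rewrite chain_boundary ?iota_uniq //.
rewrite box_sum.
have -> : iota 0 d.+1 = rcons (iota 0 d) d by rewrite -addn1 iotaD cats1.
rewrite -cats1 big_cat big_seq1 big_seq big1 => [|i]; last first.
  rewrite mem_iota add0n => id'; rewrite box_sum big_seq big1 // => s.
  rewrite mem_permutations cats1 => sp.
  apply: (@box_side d.+1 i (fun z => F (chain z s)) z) => //.
    exact: ltnW.
  move=> z' bz' z'N z'0; apply: (F0 i) => //.
  by rewrite -addn1 iotaD /= cats1.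
have -> : rem d (iota 0 d ++ [:: d]) = iota 0 d.
  have u : uniq (iota 0 d ++ [:: d]).
    by have := iota_uniq 0 d.+1; rewrite -addn1 iotaD.
  rewrite rem_filter // filter_cat /= eqxx cats0.
  by apply/all_filterP/allP => j; rewrite mem_iota /= => /ltn_eqF->.
rewrite Monoid.mul1m box_sum -big_split; apply: eq_bigr => s _ /=.
exact: (@box_last d (fun z => F (chain z s)) z).
Qed.

End Kuhn.


(** * Antipodal symmetry and the parity argument *)

Section Fan.
Variable N : nat.
Implicit Types (z : pt) (s l : seq nat).

Definition anti d z : pt := fun i => if i < d then N - z i else z i.

Lemma antiE d z i : anti d z i = if i < d then N - z i else z i.
Proof. by []. Qed.

Lemma last_chain z0 z s j : last z0 (chain z s) j = z j + count_mem j s.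
Proof.
elim: s z0 z => [|i s IH] z0 z /=; first by rewrite addn0.
by rewrite IH stepE -addnA (eq_sym j).
Qed.

(** The antipode reverses every edge, so the image chain is read backwards. The bound [z i < N]
    keeps truncated subtraction exact. *)
Lemma chain_anti d z s : uniq s -> (forall i, i \in s -> i < d) ->
  (forall i, i \in s -> z i < N) ->
  rev (map (anti d) (chain z s)) = chain (anti d (last z (chain z s))) (rev s).
Proof.
elim: s z => [|i s IH] z //= /andP[is' us] sd sN.
have E : rev (map (anti d) (chain (step z i) s)) =
    chain (anti d (last (step z i) (chain (step z i) s))) (rev s).
  apply: IH => // j js; first by apply: sd; rewrite inE js orbT.
  rewrite stepE; have -> : (j == i) = false.
    by apply/negP => /eqP ji; rewrite -ji js in is'.
  by rewrite addn0; apply: sN; rewrite inE js orbT.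
rewrite !rev_cons chain_rcons.
have -> : last z (chain (step z i) s) = last (step z i) (chain (step z i) s).
  by case: (s).
rewrite -E; congr rcons.
have -> x : last x (rev (map (anti d) (chain (step z i) s))) = anti d (step z i).
  by case: (s) => [|j t] //=; rewrite rev_cons last_rcons.
apply/funext => j; rewrite stepE !antiE stepE.
case: eqP => [->|_]; last by rewrite !addn0.
by rewrite sd ?mem_head //; have := sN i (mem_head _ _); lia.
Qed.

(** The antipode maps the unit cell based at [z] to the one based at [flip d z], hence the
    [N.-1]. *)
Definition flip d z : pt := fun i => if i < d then N.-1 - z i else z i.

Lemma box_flip d F z : bounded N z ->
  box N d (fun z => F (flip d z)) z = box N d F z.
Proof.
elim: d F z => [|d IH] F z bz /=; first by congr F; apply/funext.
rewrite (reindex_inj rev_ord_inj) /=; apply: eq_bigr => k _.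
have kN := ltn_ord k.
set z1 := upd z d _.
have bz1 : bounded N z1 by apply: bounded_upd => //; lia.
rewrite (@eq_box N d _ (fun z' => F (upd (flip d z') d k))) //; last first.
  move=> z' _ _ z'z; congr F; apply/funext => i; rewrite updE /flip ltnS.
  case: (ltngtP i d) => // ->; rewrite z'z // /z1 updE eqxx; lia.
by rewrite (IH (fun z => F (upd z d k))) // box_upd // /z1 updU.
Qed.

(** The Kuhn triangulation is invariant under the antipode: permutations are reindexed by reversal,
    base points by [flip]. *)
Lemma total_anti d F z : bounded N z -> (forall v, F (rev v) = F v) ->
  total N d (fun v => F (map (anti d) v)) z = total N d F z.
Proof.
move=> bz Fr; rewrite /total.
have pr : perm_eq (permutations (iota 0 d)) (map rev (permutations (iota 0 d))).
  apply: uniq_perm; rewrite ?map_inj_uniq ?permutations_uniq //.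
    exact: (can_inj revK).
  move=> s; rewrite mem_permutations; apply/idP/mapP => [sl'|[t tl ->]].
    by exists (rev s); rewrite ?revK // mem_permutations perm_rev.
  by rewrite perm_rev -mem_permutations.
rewrite [RHS](perm_big _ pr) /= big_map big_seq [RHS]big_seq.
apply: eq_bigr => s; rewrite mem_permutations => sp.
rewrite -[RHS]box_flip //; apply: eq_box => // z' bz' z'N _.
have sd i : i \in s = (i < d) by rewrite (perm_mem sp) mem_iota.
have us : uniq s by rewrite (perm_uniq sp) iota_uniq.
rewrite -Fr chain_anti // => [|i|i]; rewrite ?sd //; last exact: z'N.
congr (F (chain _ _)); apply/funext => i; rewrite antiE last_chain.
rewrite count_uniq_mem // sd /flip; case: ltnP => id'; last by rewrite addn0.
lia.
Qed.

Lemma chain_upd z s e k : e \notin s ->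
  map (fun v => upd v e k) (chain z s) = chain (upd z e k) s.
Proof.
elim: s z => //= i s IH z; rewrite inE negb_or => /andP[ei es].
rewrite IH // /step upd_comm 1?eq_sym // updE.
by rewrite eq_sym (negPf ei).
Qed.

Lemma total_upd d e k F z : d <= e -> bounded N z ->
  total N d (fun v => F (map (fun v => upd v e k) v)) z =
  total N d F (upd z e k).
Proof.
move=> de bz; rewrite /total big_seq [RHS]big_seq; apply: eq_bigr => s.
rewrite mem_permutations => sp.
rewrite -(@box_upd N d e (fun z => F (chain z s))) //; apply: eq_box => // z' *.
by rewrite chain_upd // (perm_mem sp) mem_iota /=; lia.
Qed.

Definition near_pt (v w : pt) := forall i, v i <= (w i).+1 /\ w i <= (v i).+1.

Lemma chain_near z s v w : uniq s -> v \in chain z s -> w \in chain z s ->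
  near_pt v w.
Proof.
move=> us vc wc i; have := mem_chain i vc; have := mem_chain i wc.
by rewrite count_uniq_mem //; case: (i \in s) => /= /andP[? ?] /andP[? ?]; lia.
Qed.

Lemma chain_split z s j : j \in s ->
  exists p v q, chain z s = p ++ v :: step v j :: q.
Proof.
elim: s z => // i s IH z; rewrite inE chain_cons.
case: (eqVneq j i) => [-> _|_ /= /(IH (step z i)) [p [v [q ->]]]].
  by exists [::], z; case: s {IH} => [|k s]; eexists.
by exists (z :: p), v, q.
Qed.

Lemma chain_bounded z s v : uniq s -> bounded N z ->
  (forall i, i \in s -> z i < N) -> v \in chain z s -> bounded N v.
Proof.
move=> us bz sN vc i; have := mem_chain i vc; rewrite count_uniq_mem //.
case: (boolP (i \in s)) => [/sN|] /=; have := bz i; lia.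
Qed.

Definition compatible (La : pt -> label) := forall v w,
  bounded N v -> bounded N w -> near_pt v w -> La v <> neg (La w).

Lemma chain_nc La z s : compatible La -> uniq s -> bounded N z ->
  (forall i, i \in s -> z i < N) -> nc (map La (chain z s)).
Proof.
move=> cLa us bz sN x y /mapP[v vc ->] /mapP[w wc ->].
apply: cLa; [exact: chain_bounded vc|exact: chain_bounded wc|].
exact: chain_near vc wc.
Qed.

Definition altsum (La : pt -> label) b d z :=
  total N d (fun v => alt b (map La v)) z.

Lemma altsum_dels La b d z :
  total N d (fun c => \xor_(v <- dels c) alt b (map La v)) z =
  altsum La b d z (+) altsum La (~~ b) d z.
Proof.
rewrite -total_add; congr (total N d _ z); apply/funext => c.
by rewrite -alt_dels -map_dels big_map.
Qed.

Lemma eq_altsum La La' b d z : bounded N z ->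
  (forall v, bounded N v -> (forall i, d <= i -> v i = z i) -> La v = La' v) ->
  altsum La b d z = altsum La' b d z.
Proof.
move=> bz LL; apply: eq_total => // z' s bz' z'N z'z sp; congr alt.
apply/eq_in_map => v vc.
have us : uniq s by rewrite (perm_uniq sp) iota_uniq.
apply: LL.
  by apply: chain_bounded vc => // i; rewrite (perm_mem sp) mem_iota; exact: z'N.
move=> i di; have := mem_chain i vc; rewrite count_uniq_mem // (perm_mem sp).
by rewrite mem_iota /= add0n ltnNge di /= z'z // addn0 -eqn_leq => /eqP->.
Qed.

Lemma altsum_neg La b d z : compatible La -> bounded N z ->
  altsum (neg \o La) b d z = altsum La (~~ b) d z.
Proof.
move=> cLa bz; apply: eq_total => // z' s bz' z'N z'z sp.
rewrite map_comp alt_neg //; apply: chain_nc => //.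
  by rewrite (perm_uniq sp) iota_uniq.
by move=> i; rewrite (perm_mem sp) mem_iota; exact: z'N.
Qed.

Lemma altsum_anti La b d z : bounded N z ->
  altsum (La \o anti d) b d z = altsum La b d z.
Proof.
move=> bz; rewrite -[RHS]total_anti //.
  by apply: eq_total => // *; rewrite map_comp.
by move=> v; apply: alt_perm; rewrite map_rev perm_rev.
Qed.

(** [La j] labels a hemisphere of dimension [j]. [U] and [W] label a homotopy over the two
    hemispheres of dimension [m], both parametrized by the same cube and glued along its boundary.
    Coordinate [m] is time: the labelling is even at time 0 and odd at time [N]. *)
Variables (m : nat) (La : nat -> pt -> label) (U W : pt -> label).

Hypothesis La_compatible : forall j, j <= m -> compatible (La j).
Hypothesis La_local : forall j z k, La j (upd z j k) = La j z.
Hypothesis La_top : forall j z, j < m -> bounded N z -> z j = N ->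
  La j.+1 z = La j z.
Hypothesis La_bottom : forall j z, j < m -> bounded N z -> z j = 0 ->
  La j.+1 z = neg (La j (anti j z)).
Hypothesis La_side : forall j i z, j < m -> bounded N z -> i < j ->
  z i = 0 \/ z i = N -> z j < N -> La j.+1 (step z j) = La j.+1 z.

(* On the lateral faces the labels do not depend on the last coordinate, hence
   no simplex there is alternating; the top and bottom faces of the cube of
   dimension [j.+1] carry [La j] and its antipodal copy. *)
Lemma fan j z : j <= m -> bounded N z ->
  altsum (La j) true j z (+) altsum (La j) false j z = true.
Proof.
elim: j z => [|j IH] z jm bz.
  by rewrite /altsum /total /= !big_seq1 /alt /sort /= eqb_id; case: (La 0 z).2.
have b0 : bounded N (upd z j 0) by exact: bounded_upd.
have bN : bounded N (upd z j N) by exact: bounded_upd.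
rewrite -altsum_dels stokes //; last first.
  move=> i s z' ij sp bz' z'N z'0.
  have us : uniq s by rewrite (perm_uniq sp) rem_uniq // iota_uniq.
  have sE k : k \in s = (k != i) && (k < j.+1).
    by rewrite (perm_mem sp) mem_rem_uniq ?iota_uniq // inE mem_iota.
  have sN k : k \in s -> z' k < N.
    by rewrite sE => /andP[ki kj]; exact: z'N.
  apply/negP => /(alt_uniq (chain_nc (La_compatible jm) us bz' sN)).
  have js : j \in s by rewrite sE ltnSn andbT gtn_eqF.
  have [p [v [q E]]] := chain_split z' js.
  have vc : v \in chain z' s by rewrite E mem_cat mem_head orbT.
  have wc : step v j \in chain z' s by rewrite E mem_cat !inE eqxx !orbT.
  have bv := chain_bounded us bz' sN vc.
  have vj : v j < N.
    by have := chain_bounded us bz' sN wc j; rewrite stepE eqxx addn1.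
  have vi : v i = z' i.
    have := mem_chain i vc; rewrite count_uniq_mem // sE eqxx /=.
    by rewrite addn0 -eqn_leq => /eqP->.
  rewrite E !map_cat cat_uniq /= (La_side jm bv ij) ?vi // mem_head.
  by rewrite !andbF.
rewrite -!/(altsum _ _ _ _).
have -> : altsum (La j.+1) true j (upd z j N) = altsum (La j) true j (upd z j N).
  by apply: eq_altsum => // v bv vz; apply: La_top => //; rewrite vz // updE eqxx.
rewrite -[RHS](IH _ (ltnW jm) bN); congr addb.
transitivity (altsum (neg \o (La j \o anti j)) true j (upd z j 0)).
  apply: eq_altsum => // v bv vz.
  by apply: La_bottom => //; rewrite vz // updE eqxx.
have cLa : compatible (La j \o anti j).
  move=> v w bv bw vw /=; apply: La_compatible; first exact: ltnW.
  - by move=> i; rewrite antiE; case: ifP => // _; exact: leq_subr.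
  - by move=> i; rewrite antiE; case: ifP => // _; exact: leq_subr.
  - move=> i; rewrite !antiE; case: ifP => // _; have [? ?] := vw i; lia.
rewrite altsum_neg // altsum_anti // /altsum.
rewrite -(@total_upd j j N (fun v => alt false (map (La j) v)) z) //.
rewrite -(@total_upd j j 0 (fun v => alt false (map (La j) v)) z) //.
apply: eq_total => // z' s _ _ _ _; congr alt; rewrite -!map_comp.
by apply: eq_map => v /=; rewrite !La_local.
Qed.

Hypothesis U_compatible : compatible U.
Hypothesis W_compatible : compatible W.
Hypothesis U_bounded : forall z, bounded N z -> (U z).1 < m.+1.
Hypothesis W_bounded : forall z, bounded N z -> (W z).1 < m.+1.
Hypothesis UW_side : forall i z, bounded N z -> i < m ->
  z i = 0 \/ z i = N -> U z = W z.
Hypothesis U_top : forall z, bounded N z -> z m = N -> U z = La m z.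
Hypothesis W_top : forall z, bounded N z -> z m = N -> W z = neg (La m (anti m z)).
Hypothesis UW_bottom : forall z, bounded N z -> z m = 0 -> W z = U (anti m z).

(** A simplex of dimension [m.+1] has [m.+2] labels of at most [m.+1] absolute values, so none is
    alternating and the alternating facets have even total. The lateral facets of [U] and [W]
    cancel, and so do the bottom ones by evenness. The top ones give the two terms of [fan], whose
    sum is odd. *)
Theorem no_odd_even_homotopy : False.
Proof.
pose z : pt := fun=> 0.
have bz : bounded N z by [].
have b0 : bounded N (upd z m 0) by exact: bounded_upd.
have bN : bounded N (upd z m N) by exact: bounded_upd.
pose F v := alt true (map U v) (+) alt true (map W v).
have vanish La' : compatible La' ->
    (forall z, bounded N z -> (La' z).1 < m.+1) ->
    total N m.+1 (fun c => \xor_(v <- dels c) alt true (map La' v)) z = false.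
  move=> cLa' bLa'; transitivity (total N m.+1 (fun=> false) z); last first.
    exact: total_false.
  apply: eq_total => // z' s bz' z'N _ sp.
  have us : uniq s by rewrite (perm_uniq sp) iota_uniq.
  have sN i : i \in s -> z' i < N by rewrite (perm_mem sp) mem_iota; exact: z'N.
  have := alt_dels true (map La' (chain z' s)).
  rewrite -map_dels big_map => E; rewrite E.
  have ncl := chain_nc cLa' us bz' sN.
  have bl x : x \in map La' (chain z' s) -> x.1 < m.+1.
    by case/mapP => v vc ->; apply: bLa'; exact: chain_bounded vc.
  have sl : m.+1 < size (map La' (chain z' s)).
    by rewrite size_map size_chain (perm_size sp) size_iota.
  by rewrite !(alt_bounded _ ncl bl sl).
have := vanish _ U_compatible U_bounded; have := vanish _ W_compatible W_bounded.
move=> tW tU.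
have : total N m.+1 (fun c => \xor_(v <- dels c) F v) z = false.
  rewrite -[RHS]/(false (+) false) -[X in X (+) _]tU -[X in _ (+) X]tW -total_add.
  by congr (total N m.+1 _ z); apply/funext => c; rewrite big_split.
rewrite stokes //; last first.
  move=> i s z' im sp bz' z'N z'0.
  have us : uniq s by rewrite (perm_uniq sp) rem_uniq // iota_uniq.
  have sE k : k \in s = (k != i) && (k < m.+1).
    by rewrite (perm_mem sp) mem_rem_uniq ?iota_uniq // inE mem_iota.
  have sN k : k \in s -> z' k < N.
    by rewrite sE => /andP[ki kj]; exact: z'N.
  rewrite /F; suff -> : map U (chain z' s) = map W (chain z' s) by rewrite addbb.
  apply/eq_in_map => v vc; apply: (UW_side (i := i)) => //.
    exact: chain_bounded vc.
  have := mem_chain i vc; rewrite count_uniq_mem // sE eqxx /=.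
  by rewrite addn0 -eqn_leq => /eqP<-.
rewrite !total_add -!/(altsum _ _ _ _).
have -> : altsum U true m (upd z m N) = altsum (La m) true m (upd z m N).
  by apply: eq_altsum => // v bv vz; apply: U_top => //; rewrite vz // updE eqxx.
have -> : altsum W true m (upd z m 0) = altsum U true m (upd z m 0).
  rewrite -[RHS]altsum_anti //; apply: eq_altsum => // v bv vz.
  by apply: UW_bottom => //; rewrite vz // updE eqxx.
have -> : altsum W true m (upd z m N) = altsum (La m) false m (upd z m N).
  have cLa : compatible (La m \o anti m).
    move=> v w bv bw vw /=; apply: La_compatible => //.
    - by move=> i; rewrite antiE; case: ifP => // _; exact: leq_subr.
    - by move=> i; rewrite antiE; case: ifP => // _; exact: leq_subr.
    - move=> i; rewrite !antiE; case: ifP => // _; have [? ?] := vw i; lia.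
  rewrite -[RHS]altsum_anti // -[RHS](altsum_neg true m cLa) //.
  by apply: eq_altsum => // v bv vz; apply: W_top => //; rewrite vz // updE eqxx.
by rewrite fan // addbb.
Qed.

End Fan.

(** * Equivariant maps of spheres *)

Local Open Scope classical_set_scope.
Local Open Scope ring_scope.

(** * Continuity of elementary constructions *)

Section General.
Variable R : realType.

Lemma continuous_compT (T U V : topologicalType) (g : U -> V) (f : T -> U) :
  continuous g -> continuous f -> continuous (fun x => g (f x)).
Proof. by move=> cg cf x; apply: continuous_comp; [exact: cf | exact: cg]. Qed.

Lemma continuous_pair (T U V : topologicalType) (f : T -> U) (g : T -> V) :
  continuous f -> continuous g -> continuous (fun x => (f x, g x)).
Proof. by move=> cf cg x; apply: cvg_pair; [exact: cf | exact: cg]. Qed.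

Lemma continuous_rowP (T : topologicalType) n (f : T -> 'rV[R]_n) :
  (forall i, continuous (fun x => f x 0 i)) -> continuous f.
Proof.
move=> cf x A [P Px PA]; rewrite nbhs_simpl /=.
have : \forall y \near x, forall i : 'I_n, P 0 i (f y 0 i).
  by apply: filter_forall => i; apply: cf; exact: Px.
by apply: filterS => y Py; apply: PA => i j; rewrite (ord1 i); exact: Py.
Qed.

Lemma continuous_paste (T U : topologicalType) (f g : T -> U) (a b : T -> R) :
  continuous f -> continuous g -> continuous a -> continuous b ->
  (forall x, a x = b x -> f x = g x) ->
  continuous (fun x => if a x <= b x then f x else g x).
Proof.
move=> cf cg ca cb fg; set h := (fun x => _).
apply/continuous_subspace_setT.
have -> : [set: T] = [set x | a x <= b x] `|` [set x | b x <= a x].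
  by apply/seteqP; split => // x _; case: (leP (a x) (b x)) => [|/ltW]; [left|right].
have cab : continuous (fun x => a x - b x : R).
  by move=> x; apply: continuousB; [exact: ca | exact: cb].
have cba : continuous (fun x => b x - a x : R).
  by move=> x; apply: continuousB; [exact: cb | exact: ca].
apply: withinU_continuous.
- have -> : [set x | a x <= b x] = (fun x => a x - b x) @^-1` [set y | y <= 0].
    by apply/seteqP; split => x /=; rewrite subr_le0.
  by apply: preimage_closed; [move=> x _; exact: cab | exact: closed_le].
- have -> : [set x | b x <= a x] = (fun x => b x - a x) @^-1` [set y | y <= 0].
    by apply/seteqP; split => x /=; rewrite subr_le0.
  by apply: preimage_closed; [move=> x _; exact: cba | exact: closed_le].
- apply: (@subspace_eq_continuous _ _ _ f).
    by move=> x; rewrite inE /= => ab; rewrite /from_subspace /h ab.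
  exact: continuous_subspaceT.
- apply: (@subspace_eq_continuous _ _ _ g).
    move=> x; rewrite inE /= => ba; rewrite /from_subspace /h; case: ifP => // ab.
    by rewrite fg //; apply/eqP; rewrite eq_le ab ba.
  exact: continuous_subspaceT.
Qed.

Lemma continuous_within_comp (T U V : topologicalType) (A : set U)
    (f : U -> V) (c : T -> U) :
  {within A, continuous f} -> continuous c -> (forall x, A (c x)) ->
  continuous (fun x => f (c x)).
Proof.
move=> /subspace_continuousP cf cc Ac x W Wx.
have := cf _ (Ac x) _ Wx; rewrite /nbhs /= /within /= => H.
have := cc x _ H; rewrite /= !nbhs_simpl /=.
by apply: filterS => y; apply; exact: Ac.
Qed.

Section RealFunctions.
Variables (T : topologicalType) (f g : T -> R).
Hypotheses (cf : continuous f) (cg : continuous g).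

Lemma cts_add : continuous (fun x => f x + g x).
Proof. by move=> x; apply: cvgD; [exact: cf | exact: cg]. Qed.

Lemma cts_sub : continuous (fun x => f x - g x).
Proof. by move=> x; apply: cvgB; [exact: cf | exact: cg]. Qed.

Lemma cts_mul : continuous (fun x => f x * g x).
Proof. by move=> x; apply: cvgM; [exact: cf | exact: cg]. Qed.

Lemma cts_max : continuous (fun x => Num.max (f x) (g x)).
Proof. by move=> x; apply: (@continuous_max R T f g x); [exact: cf | exact: cg]. Qed.

Lemma cts_min : continuous (fun x => Num.min (f x) (g x)).
Proof. by move=> x; apply: (@continuous_min R T f g x); [exact: cf | exact: cg]. Qed.

Lemma cts_div : (forall x, g x != 0) -> continuous (fun x => f x / g x).
Proof.
move=> g0 x; apply: cvgM; first exact: cf.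
by apply: cvgV => //; exact: cg.
Qed.

End RealFunctions.

Lemma cts_id (T : topologicalType) : continuous (fun x : T => x).
Proof. by move=> x; exact: cvg_id. Qed.

Lemma cts_cst (T U : topologicalType) (a : U) : continuous (fun _ : T => a).
Proof. by move=> x; exact: cvg_cst. Qed.

End General.

(** * Radial coordinates on the cube *)

Section Cube.
Variables (R : realType) (n : nat).
Local Notation V := 'rV[R]_n.
Implicit Types (x : V) (l : R).

Definition cube_center : V := const_mx 2^-1.
(** The norm is the maximum norm, so this radius equals 1 exactly on the boundary of the cube. *)
Definition rho x : R := 2 * `|x - cube_center|.
Definition sc l x : V := cube_center + l *: (x - cube_center).
(** This retraction extends maps from the cube to the whole space, where plain continuity can be
    used. *)
Definition clamp x : V := \row_j Num.max 0 (Num.min 1 (x 0 j)).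

Lemma rho_ge0 x : 0 <= rho x.
Proof. by rewrite mulr_ge0. Qed.

Lemma rho_sc l x : rho (sc l x) = `|l| * rho x.
Proof. by rewrite /rho /sc [cube_center + _]addrC addrK normrZ mulrCA. Qed.

Lemma sc1 x : sc 1 x = x.
Proof. by rewrite /sc scale1r addrC subrK. Qed.

Lemma sc0 x : sc 0 x = cube_center.
Proof. by rewrite /sc scale0r addr0. Qed.

Lemma sc_sc l l' x : sc l (sc l' x) = sc (l * l') x.
Proof. by rewrite /sc [cube_center + _ *: _ - _]addrC addKr scalerA. Qed.

Lemma rho_leP x l : 0 <= l -> (rho x <= l) <-> forall j, `|2 * x 0 j - 1| <= l.
Proof.
move=> l0.
have E j : `|2 * x 0 j - 1| = 2 * `|(x - cube_center) 0 j|.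
  rewrite -[2 in RHS]ger0_norm // -normrM /cube_center !mxE mulrBr.
  by rewrite mulfV ?pnatr_eq0.
have -> : (rho x <= l) = (`|x - cube_center| <= l / 2).
  by rewrite ler_pdivlMr // mulrC.
rewrite {1}/Num.norm /= mx_normrE; split => [H j|H].
  rewrite E mulrC -ler_pdivlMr //; apply: le_trans H.
  by apply: (le_bigmax _ (fun i => `|(x - cube_center) i.1 i.2|) (0, j)).
apply/bigmax_leP; split => [|[i j] _ /=]; first by rewrite divr_ge0.
by rewrite ler_pdivlMr // mulrC (ord1 i) -E.
Qed.

Lemma cubeP x : cube x <-> rho x <= 1.
Proof.
rewrite rho_leP //; split => H j; have := H j; rewrite ler_norml => /andP[? ?].
  by apply/andP; split; lra.
by apply/andP; split; lra.
Qed.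

Lemma clamp_cube x : cube (clamp x).
Proof.
move=> j; rewrite mxE le_max lexx /= ge_max ler01 /=.
by rewrite ge_min lexx.
Qed.

Lemma clamp_id x : cube x -> clamp x = x.
Proof.
move=> cx; apply/rowP => j; rewrite mxE; have /andP[x0 x1] := cx j.
by rewrite min_r // max_r.
Qed.

Lemma boundaryP x : cube_boundary x <-> rho x = 1.
Proof.
split=> [[/cubeP c [j xj]]|r1].
  apply/eqP; rewrite eq_le c /= leNgt; apply/negP => lt1.
  have := (rho_leP x (rho_ge0 x)).1 (lexx _) j; rewrite leNgt => /negP; apply.
  apply: lt_le_trans lt1 _.
  case: xj => ->; rewrite ?mulr0 ?mulr1 ?sub0r ?normrN ?normr1 // ler_normr.
  by apply/orP; left; lra.
have cx : cube x by apply/cubeP; rewrite r1.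
split=> //; apply: contrapT => H.
have lt j : `|2 * x 0 j - 1| < 1.
  have /andP[x0 x1] := cx j; rewrite ltr_norml; apply/andP.
  have : x 0 j != 0 by apply/eqP => e; apply: H; exists j; left.
  have : x 0 j != 1 by apply/eqP => e; apply: H; exists j; right.
  by rewrite !neq_lt => /orP[] ? /orP[] ?; split; lra.
pose l := \big[Num.max/0]_(j < n) `|2 * x 0 j - 1|.
have l1 : l < 1 by apply/bigmax_ltP; split.
have l0 : 0 <= l by apply: bigmax_ge_id.
have : rho x <= l.
  by apply/rho_leP => // j; exact: (le_bigmax _ (fun j => `|2 * x 0 j - 1|)).
by rewrite r1 leNgt l1.
Qed.

Lemma clamp_boundary x : 1 <= rho x -> cube_boundary (clamp x).
Proof.
move=> r1; split; first exact: clamp_cube.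
apply: contrapT => H.
suff cx : cube x.
  apply: H; have /boundaryP[_ [j xj]] : rho x = 1.
    by apply/eqP; rewrite eq_le r1 andbT; apply/cubeP.
  by exists j; rewrite (clamp_id cx).
move=> j; rewrite leNgt [x 0 j <= 1]leNgt; apply/andP; split; apply/negP => xj.
  apply: H; exists j; left; rewrite mxE; apply: max_l.
  by rewrite ge_min (ltW xj) orbT.
by apply: H; exists j; right; rewrite mxE min_l ?max_r // ltW.
Qed.

Lemma continuous_rho : continuous rho.
Proof.
move=> x; apply: (@continuousM R V (fun=> 2) (fun x => `|x - cube_center|)).
  exact: cst_continuous.
apply: (@continuous_compT V V R _ (fun x => x - cube_center)).
  exact: norm_continuous.
move=> y; apply: (@continuousB R V V id (fun=> cube_center)) => //.
exact: cst_continuous.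
Qed.

Lemma continuous_sc (T : topologicalType) (l : T -> R) (f : T -> V) :
  continuous l -> continuous f -> continuous (fun t => sc (l t) (f t)).
Proof.
move=> cl cf t.
apply: (@continuousD R V T (fun=> cube_center)
  (fun t => l t *: (f t - cube_center))).
  exact: cst_continuous.
apply: (@continuousZ R V T l (fun t => f t - cube_center)); first exact: cl.
apply: (@continuousB R V T f (fun=> cube_center)); first exact: cf.
exact: cst_continuous.
Qed.

Lemma continuous_clamp : continuous clamp.
Proof.
apply: continuous_rowP => i.
under eq_fun do rewrite mxE.
apply: cts_max; first exact: cts_cst.
apply: cts_min; first exact: cts_cst.
exact: coord_continuous.
Qed.

End Cube.

(** * Null homotopies from trivial homotopy groups *)

Section Homotopy.
Variables (R : realType) (X : topologicalType) (n : nat).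
Local Notation V := 'rV[R]_n.

(** The class of [S] equals that of the constant map, and the latter contains the constant map; no
    symmetry of homotopies has to be shown. *)
Lemma trivial_null (x0 : X) (S : V -> X) :
  trivial_homotopy_group R n x0 -> spheroid x0 S ->
  rel_homotopic x0 S (cst x0).
Proof.
move=> triv sS.
have : @homotopy_group R X n x0 (homotopy_class x0 S) by exists S.
rewrite triv /= => E.
suff : homotopy_class x0 (cst x0) (cst x0 : V -> X) by rewrite -E => -[].
split.
  by split => //; apply: continuous_subspaceT; exact: cts_cst.
exists (fun=> x0); split => //.
by apply: continuous_subspaceT; exact: cts_cst.
Qed.

Lemma null_homotopy (x0 : X) (S : V -> X) :
  trivial_homotopy_group R n x0 -> continuous S ->
  (forall x, cube_boundary x -> S x = x0) ->
  exists K : R * V -> X,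
  [/\ continuous K, forall x, cube x -> K (0, x) = S x,
      forall t x, 1 <= t -> K (t, x) = x0 &
      forall t x, 1 <= rho x -> K (t, x) = x0].
Proof.
move=> triv cS S0.
have sS : spheroid x0 S by split => //; exact: continuous_subspaceT.
have [F [cF F0 F1 Fb]] := trivial_null triv sS.
pose c (p : R * V) := (Num.max 0 (Num.min 1 p.1), clamp p.2).
have i01 (t : R) : Num.max 0 (Num.min 1 t) \in `[0, 1].
  by rewrite in_itv /= le_max lexx /= ge_max ler01 /= ge_min lexx.
exists (fun p => F (c p)); split.
- apply: (continuous_within_comp cF).
    apply: continuous_pair.
      apply: cts_max; first exact: cts_cst.
      apply: cts_min; first exact: cts_cst.
      by move=> x; exact: cvg_fst.
    apply: continuous_compT; first exact: continuous_clamp.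
    by move=> x; exact: cvg_snd.
  by move=> p; split; [exact: i01 | exact: clamp_cube].
- move=> x cx; rewrite /c /= min_r // maxxx F0 clamp_id //.
- move=> t x t1; rewrite /c /= min_l // max_r // F1 //; exact: clamp_cube.
- by move=> t x r1; rewrite /c /= Fb //; exact: clamp_boundary.
Qed.

End Homotopy.

(** * Homotopies relative to the boundary *)

Section RelHomotopy.
Variables (R : realType) (X : topologicalType) (n : nat).
Local Notation V := 'rV[R]_n.
Variables f g : V -> X.
Hypotheses (cf : continuous f) (cg : continuous g).
Hypothesis fg : forall x, cube_boundary x -> f x = g x.

(* [f] on the inner half of the cube and, outside, [g] turned inside out, so
   that the boundary is sent to the value of [g] at the centre. *)
Definition two_cones (x : V) : X :=
  if rho x <= 2^-1 then f (sc 2 x)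
  else g (sc (Num.max 0 (2 - 2 * rho x) / Num.max (rho x) 2^-1) x).

(** At radius 1/2 both branches evaluate at the boundary point [sc 2 x], where [f] and [g] agree.
    The [Num.max] are inactive for radii between 1/2 and 1 and ensure continuity elsewhere. *)
Lemma two_conesE x : 2^-1 <= rho x ->
  two_cones x = g (sc (Num.max 0 (2 - 2 * rho x) / Num.max (rho x) 2^-1) x).
Proof.
rewrite /two_cones => r2; case: ifP => // r2'.
have e : rho x = 2^-1 by apply/eqP; rewrite eq_le r2 r2'.
rewrite e maxxx mulfV ?pnatr_eq0 // max_r; last by lra.
have -> : (2 - 1) / 2^-1 = 2 :> R by lra.
by rewrite fg //; apply/boundaryP; rewrite rho_sc e ger0_norm // mulfV ?pnatr_eq0.
Qed.

Lemma max_neq0 (e t : R) : 0 < e -> Num.max t e != 0.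
Proof. by move=> e0; rewrite gt_eqF // lt_max e0 orbT. Qed.

Lemma continuous_shell (h : R -> R) : continuous h ->
  continuous (fun x : V => Num.max 0 (h (rho x)) / Num.max (rho x) 2^-1).
Proof.
move=> ch; apply: cts_div; last by move=> x; apply: max_neq0; rewrite invr_gt0.
  apply: cts_max; first exact: cts_cst.
  by apply: continuous_compT => //; exact: continuous_rho.
by apply: cts_max; [exact: continuous_rho | exact: cts_cst].
Qed.

Lemma continuous_two_cones : continuous two_cones.
Proof.
apply: continuous_paste.
- apply: continuous_compT => //; apply: continuous_sc; [exact: cts_cst | exact: cts_id].
- apply: continuous_compT => //; apply: continuous_sc; last exact: cts_id.
  apply: (continuous_shell (h := fun t => 2 - 2 * t)).
  apply: cts_sub; first exact: cts_cst.
  by apply: cts_mul; [exact: cts_cst | exact: cts_id].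
- exact: continuous_rho.
- exact: cts_cst.
- move=> x rx; rewrite -two_conesE ?rx //; rewrite /two_cones rx lexx //.
Qed.

(* [g] precomposed with a map that collapses the inner half of the cube. *)
Let g' x := g (sc (Num.max 0 (2 * rho x - 1) / Num.max (rho x) 2^-1) x).

(** Let [K] contract [two_cones]. Its inner half at height 0 gives [f]; this disc is pushed, with
    its rim fixed, over the outer shell at height 0 and into the region where [K] is constant. *)
Lemma homotopy_to_collapse :
  trivial_homotopy_group R n (g (@cube_center R n)) ->
  exists F : R * V -> X,
  [/\ continuous F, forall x, cube x -> F (0, x) = f x,
      forall x, cube x -> F (1, x) = g' x &
      forall s x, cube_boundary x -> F (s, x) = f x].
Proof.
move=> triv.
have S0 x : cube_boundary x -> two_cones x = g (@cube_center R n).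
  move=> /boundaryP r1; rewrite two_conesE r1; last by lra.
  by rewrite mulr1 subrr maxxx mul0r sc0.
have [K [cK K0 K1 Kb]] := null_homotopy triv continuous_two_cones S0.
(* A straight path in the (height, radius) half-plane; its end has height at
   least 1 near the centre, where the radial direction is undefined. *)
pose tau (p : R * V) := p.1 * Num.max 0 (2 - 4 * rho p.2).
pose mu (p : R * V) := (1 - p.1) / 2 +
  p.1 * ((3 / 2 - rho p.2) / Num.max (rho p.2) 4^-1).
have half x : cube x -> K (0, sc 2^-1 x) = f x.
  move=> /cubeP cx; have r2 : rho (sc 2^-1 x) <= 2^-1.
    by rewrite rho_sc ger0_norm; lra.
  rewrite K0; last by apply/cubeP; lra.
  by rewrite /two_cones r2 sc_sc mulfV ?pnatr_eq0 // sc1.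
exists (fun p => K (tau p, sc (mu p) p.2)); split.
- have c1 : continuous (fun p : R * V => p.1) by move=> x; exact: cvg_fst.
  have c2 : continuous (fun p : R * V => p.2) by move=> x; exact: cvg_snd.
  have cr : continuous (fun p : R * V => rho p.2).
    by apply: continuous_compT => //; exact: continuous_rho.
  apply: continuous_compT => //; apply: continuous_pair.
    apply: cts_mul => //; apply: cts_max; first exact: cts_cst.
    apply: cts_sub; first exact: cts_cst.
    by apply: cts_mul => //; exact: cts_cst.
  apply: continuous_sc => //; apply: cts_add.
    apply: cts_mul; last exact: cts_cst.
    by apply: cts_sub => //; exact: cts_cst.
  apply: cts_mul => //; apply: cts_div.
  + by apply: cts_sub => //; exact: cts_cst.
  + by apply: cts_max => //; exact: cts_cst.
  + by move=> p; apply: max_neq0; rewrite invr_gt0.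
- by move=> x cx; rewrite /tau /mu /= mul0r subr0 mul0r addr0 mul1r half.
- move=> x /cubeP cx; rewrite /tau /mu /= !mul1r subrr mul0r add0r /g'.
  have r0 := rho_ge0 x.
  (* Radii at least 1/2 land in the outer shell at height 0, on [g] turned inside out; smaller ones
     land at radius or height at least 1, where [K] is constant. *)
  case: (leP 2^-1 (rho x)) => r2.
    have rn0 : rho x != 0 by rewrite gt_eqF //; lra.
    rewrite (@max_l _ _ 0) ?(@max_l _ _ (rho x) 4^-1); [|lra|lra].
    set y := sc _ x; have ry : rho y = 3 / 2 - rho x.
      rewrite /y rho_sc ger0_norm ?divfK //; apply: divr_ge0 => //; lra.
    rewrite K0; last by apply/cubeP; lra.
    rewrite two_conesE ?ry; last by lra.
    rewrite /y sc_sc !(@max_r _ _ 0); [|lra|lra].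
    rewrite (@max_l _ _ (3 / 2 - rho x)); last by lra.
    rewrite (mulrA (_ / _)) divfK; last by rewrite gt_eqF //; lra.
    congr (g (sc (_ / _) x)); lra.
  rewrite (@max_l _ _ 0 (2 * rho x - 1)); last by lra.
  rewrite mul0r sc0.
  case: (leP (rho x) 4^-1) => r4.
    by apply: K1; rewrite le_max; apply/orP; right; lra.
  apply: Kb; rewrite rho_sc ger0_norm.
    by rewrite divfK; [lra|rewrite gt_eqF //; lra].
  by apply: divr_ge0 => //; lra.
- move=> s x /boundaryP r1; rewrite /tau /mu /= r1.
  rewrite (@max_l _ _ 0) ?(@max_l _ _ 1 4^-1); [|lra|lra].
  have -> : (1 - s) / 2 + s * ((3 / 2 - 1) / 1) = 2^-1 by lra.
  by rewrite mulr0 half //; apply/cubeP; rewrite r1.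
Qed.

Lemma homotopic_rel :
  trivial_homotopy_group R n (g (@cube_center R n)) ->
  exists F : R * V -> X,
  [/\ continuous F, forall x, cube x -> F (0, x) = f x,
      forall x, cube x -> F (1, x) = g x &
      forall s x, cube_boundary x -> F (s, x) = f x].
Proof.
move=> triv; have [F [cF F0 F1 Fb]] := homotopy_to_collapse triv.
(* Interpolating the radial factor towards 1 undoes the collapse; on the boundary the factor is 1
   throughout. *)
pose mu (p : R * V) := (1 - p.1) *
  (Num.max 0 (2 * rho p.2 - 1) / Num.max (rho p.2) 2^-1) + p.1.
pose G (p : R * V) := g (sc (mu p) p.2).
have c1 : continuous (fun p : R * V => p.1) by move=> x; exact: cvg_fst.
have c2 : continuous (fun p : R * V => p.2) by move=> x; exact: cvg_snd.
have cG : continuous G.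
  apply: continuous_compT => //; apply: continuous_sc => //.
  apply: cts_add => //; apply: cts_mul.
    by apply: cts_sub => //; exact: cts_cst.
  apply: (@continuous_compT _ _ R
    (fun x : V => Num.max 0 (2 * rho x - 1) / Num.max (rho x) 2^-1)) => //.
  apply: (continuous_shell (h := fun t => 2 * t - 1)).
  apply: cts_sub; last exact: cts_cst.
  by apply: cts_mul; [exact: cts_cst | exact: cts_id].
have cc : continuous (fun p : R * V => clamp p.2).
  by apply: continuous_compT => //; exact: continuous_clamp.
exists (fun p => if p.1 <= 2^-1 then F (2 * p.1, clamp p.2)
                 else G (2 * p.1 - 1, clamp p.2)); split.
- apply: continuous_paste => //; last 2 first.
  + exact: cts_cst.
  + move=> [s x] /= ->; rewrite mulfV ?pnatr_eq0 // F1; last exact: clamp_cube.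
    by rewrite /G /mu /= subrr subr0 mul1r addr0.
  + apply: continuous_compT => //; apply: continuous_pair => //.
    by apply: cts_mul => //; exact: cts_cst.
  + apply: continuous_compT => //; apply: continuous_pair => //.
    apply: cts_sub; last exact: cts_cst.
    by apply: cts_mul => //; exact: cts_cst.
- by move=> x cx /=; rewrite ifT ?mulr0 ?clamp_id ?F0 //; lra.
- move=> x cx /=; rewrite ifF; last by apply/negbTE; rewrite -ltNge; lra.
  rewrite clamp_id // /G /mu /=.
  have -> : 2 * 1 - 1 = 1 :> R by lra.
  by rewrite subrr mul0r add0r sc1.
- move=> s x bx /=; rewrite clamp_id; last by case: bx.
  case: ifP => _; first exact: Fb.
  have r1 : rho x = 1 by apply/boundaryP.
  rewrite /G /mu /= r1 max_r ?max_l; [|lra|lra].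
  have -> : (1 - (2 * s - 1)) * ((2 * 1 - 1) / 1) + (2 * s - 1) = 1 by lra.
  by rewrite sc1 fg.
Qed.

End RelHomotopy.

(** * Equivariant maps, hemisphere by hemisphere *)

Section Tower.
Variables (R : realType) (X : topologicalType) (gam : X -> X).
Hypotheses (cgam : continuous gam) (gamK : involutive gam).

Definition last_coord j (x : 'rV[R]_j.+1) : R := x 0 ord_max.
Definition init_coords j (x : 'rV[R]_j.+1) : 'rV[R]_j :=
  \row_i x 0 (widen_ord (leqnSn j) i).
Definition antipode j (x : 'rV[R]_j) : 'rV[R]_j := const_mx 1 - x.

Lemma antipodeE j (x : 'rV[R]_j) i : antipode x 0 i = 1 - x 0 i.
Proof. by rewrite !mxE. Qed.

Lemma antipodeK j : involutive (@antipode j).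
Proof. by move=> x; apply/rowP => i; rewrite !antipodeE; lra. Qed.

Lemma antipode_cube j (x : 'rV[R]_j) : cube x -> cube (antipode x).
Proof. by move=> cx i; rewrite antipodeE; have /andP[? ?] := cx i; lra. Qed.

Lemma antipode_boundary j (x : 'rV[R]_j) :
  cube_boundary x -> cube_boundary (antipode x).
Proof.
move=> [cx [i xi]]; split; first exact: antipode_cube.
by exists i; rewrite antipodeE; case: xi => ->; [right | left]; lra.
Qed.

Lemma last_antipode j (x : 'rV[R]_j.+1) :
  last_coord (antipode x) = 1 - last_coord x.
Proof. exact: antipodeE. Qed.

Lemma init_antipode j (x : 'rV[R]_j.+1) :
  init_coords (antipode x) = antipode (init_coords x).
Proof. by apply/rowP => i; rewrite mxE !antipodeE mxE. Qed.

Lemma init_cube j (x : 'rV[R]_j.+1) : cube x -> cube (init_coords x).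
Proof. by move=> cx i; rewrite mxE; exact: cx. Qed.

Lemma continuous_antipode j : continuous (@antipode j).
Proof.
apply: continuous_rowP => i; under eq_fun do rewrite antipodeE.
by apply: cts_sub; [exact: cts_cst | exact: coord_continuous].
Qed.

Lemma continuous_init j : continuous (@init_coords j).
Proof.
apply: continuous_rowP => i; under eq_fun do rewrite mxE.
exact: coord_continuous.
Qed.

(** The cube stands for a hemisphere, so equivariance concerns only its boundary sphere. *)
Definition antipodal j (h : 'rV[R]_j -> X) :=
  continuous h /\ forall x, cube_boundary x -> h (antipode x) = gam (h x).

(* [h'] on the cube of dimension [j.+1] is a homotopy, constant on the
   boundary, from [gam \o h \o antipode] to [h]; on the boundary of that cube
   it is an equivariant map from a sphere with hemispheres [h] and its image
   under the involutions. *)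
Definition hemisphere j (h : 'rV[R]_j -> X) (h' : 'rV[R]_j.+1 -> X) :=
  [/\ forall x, cube x -> last_coord x = 1 -> h' x = h (init_coords x),
      forall x, cube x -> last_coord x = 0 ->
        h' x = gam (h (antipode (init_coords x))) &
      forall x, cube x -> cube_boundary (init_coords x) ->
        h' x = h (init_coords x)].

(** Since [h] is antipodal and [gam] an involution, [h] and [gam \o h \o antipode] agree on the
    boundary; [homotopic_rel] joins them. *)
Lemma hemisphere_exists j (h : 'rV[R]_j -> X) :
  (forall x0 : X, trivial_homotopy_group R j x0) -> antipodal h ->
  exists h', antipodal h' /\ hemisphere h h'.
Proof.
move=> triv [ch ah]; pose g x := gam (h (antipode x)).
have cg : continuous g.
  apply: continuous_compT => //; apply: continuous_compT => //.
  exact: continuous_antipode.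
have hg x : cube_boundary x -> h x = g x by move=> bx; rewrite /g ah // gamK.
have [F [cF F0 F1 Fb]] := homotopic_rel ch cg hg (triv _).
pose h' (x : 'rV[R]_j.+1) := F (1 - last_coord x, init_coords x).
have hh' : hemisphere h h'.
  split => x cx.
  - by move=> x1; rewrite /h' x1 subrr F0 //; exact: init_cube.
  - by move=> x0; rewrite /h' x0 subr0 F1 //; exact: init_cube.
  - by move=> bx; rewrite /h' Fb.
exists h'; split => //; split.
  apply: continuous_compT => //; apply: continuous_pair.
    by apply: cts_sub; [exact: cts_cst | exact: coord_continuous].
  exact: continuous_init.
have [h1 h0 hb] := hh'.
move=> x bx; have [cx [i xi]] := bx.
have cax := antipode_cube cx.
case: (unliftP ord_max i) => [i' ii'|ii'].
  have bi : cube_boundary (init_coords x).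
    split; first exact: init_cube.
    exists i'; rewrite mxE; have -> // : widen_ord (leqnSn j) i' = i.
    by rewrite ii'; apply/val_inj => /=; rewrite /bump leqNgt ltn_ord.
  rewrite (hb _ cx bi) hb //; last by rewrite init_antipode; exact: antipode_boundary.
  by rewrite init_antipode ah.
rewrite ii' in xi; have {xi}[xi|xi] : last_coord x = 0 \/ last_coord x = 1 := xi.
  rewrite (h0 _ cx xi) h1 //; last by rewrite last_antipode xi subr0.
  by rewrite init_antipode gamK.
rewrite (h1 _ cx xi) h0 //; last by rewrite last_antipode xi subrr.
by rewrite init_antipode antipodeK.
Qed.

Lemma antipodal_tower m (x0 : X) :
  (forall j (x1 : X), (j < m)%N -> trivial_homotopy_group R j x1) ->
  exists h : forall j, 'rV[R]_j -> X,
    (forall j, (j <= m)%N -> antipodal (h j)) /\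
    (forall j, (j < m)%N -> hemisphere (h j) (h j.+1)).
Proof.
move=> triv.
(* The default [cst x0] can be reached only in dimensions from [m] on. *)
pose next j (h : 'rV[R]_j -> X) : 'rV[R]_j.+1 -> X :=
  if pselect (exists h', antipodal h' /\ hemisphere h h') is left e
  then projT1 (cid e) else cst x0.
pose fix h j : 'rV[R]_j -> X :=
  if j is j'.+1 then next j' (h j') else cst x0.
have nextP j : (j < m)%N -> antipodal (h j) ->
    antipodal (h j.+1) /\ hemisphere (h j) (h j.+1).
  move=> jm ah; rewrite /= /next; case: pselect => [e|[]].
    exact: projT2 (cid e).
  by apply: hemisphere_exists => // x1; exact: triv.
(* The tower starts with a constant map on the cube of dimension 0, whose boundary is empty. *)
have ah j : (j <= m)%N -> antipodal (h j).
  elim: j => [_|j IH jm]; last by have [] := nextP j jm (IH (ltnW jm)).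
  by split=> [|x [_ [[]]]//]; exact: cts_cst.
by exists h; split => // j jm; have [] := nextP j jm (ah j (ltnW jm)).
Qed.

End Tower.

(** * Uniform continuity on the cube *)

Section UniformContinuity.
Variables (R : realType) (n : nat).

Lemma cube_compact : compact (@cube R n).
Proof.
have -> : @cube R n = [set x | forall i, `[0, 1]%classic (x 0 i)].
  by apply/seteqP; split => x cx i; have := cx i; rewrite /= in_itv.
by apply: (@rV_compact R n (fun=> `[0, 1]%classic)) => i; exact: segment_compact.
Qed.

(** Heine-Cantor, stated with a filter so that finitely many functions can share one modulus. *)
Lemma cube_uniform (f : 'rV[R]_n -> R) (e : R) : continuous f -> 0 < e ->
  \forall d \near 0^'+, forall x y, cube x -> `|x - y| < d -> `|f x - f y| < e.
Proof.
move=> cf e0.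
have := @cube_compact; rewrite compact_near_coveringP => /(_ _ (0^'+ : set_system R)
  (fun d x => forall y, `|x - y| < d -> `|f x - f y| < e)) H.
suff : \forall d \near 0^'+, @cube R n `<=`
    (fun x => forall y, `|x - y| < d -> `|f x - f y| < e).
  by apply: filterS => d H' x y cx; exact: H'.
apply: H => x cx.
have [d d0 xd] : exists2 d, 0 < d & forall y, `|x - y| < d -> `|f x - f y| < e / 2.
  have := cf x; move/cvgrPdist_lt => /(_ (e / 2)); rewrite divr_gt0 // => /(_ isT).
  move=> /nbhs_ballP[d /= d0 xd]; exists d => // y xy.
  by apply: xd; rewrite -ball_normE.
have d2 : 0 < d / 2 by rewrite divr_gt0.
exists (ball x (d / 2), [set d' | d' < d / 2]).
  split; first exact: nbhsx_ballx.
  exact: nbhs_right_lt.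
move=> [z d'] [/= xz d'd] y zy; rewrite -ball_normE /= in xz.
have -> : f z - f y = (f x - f y) - (f x - f z) by rewrite opprB addrCA addrC; ring.
apply: le_lt_trans (ler_normB _ _) _.
have -> : e = e / 2 + e / 2 by lra.
apply: ltrD; apply: xd; last by lra.
have -> : x - y = (x - z) + (z - y) by rewrite addrA subrK.
apply: le_lt_trans (ler_normD _ _) _; lra.
Qed.

End UniformContinuity.

(** * From odd-even homotopies to labellings *)

(* [fa t - fb t] plays the role of a map to a sphere at time [t]; by [fafb],
   consecutive maps are nowhere opposite. *)
Section Levels.
Variables (R : realType) (X : topologicalType) (gam : X -> X) (m L : nat).
Variables fa fb : nat -> 'I_m.+2 -> X -> R.
Hypothesis cgam : continuous gam.
Hypothesis gamK : involutive gam.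
Hypothesis cfa : forall t a, continuous (fa t a).
Hypothesis fa_sum : forall t w, \sum_a fa t a w = 1.
Hypothesis fb_sum : forall t w, \sum_a fb t a w = 1.
Hypothesis fafb : forall t t' a w, (t <= L)%N -> (t' <= L)%N ->
  (t <= t'.+1)%N -> (t' <= t.+1)%N -> 0 < fa t a w -> 0 < fb t' a w -> False.
Hypothesis fa_even : forall a w, fa 0 a (gam w) = fa 0 a w.
Hypothesis fb_even : forall a w, fb 0 a (gam w) = fb 0 a w.
Hypothesis fa_odd : forall a w, fa L a (gam w) = fb L a w.
Hypothesis fb_odd : forall a w, fb L a (gam w) = fa L a w.

Local Notation eps := (m.+2%:R^-1 : R).

(* A hyperplane of sum-zero vectors is parametrized by all coordinates but the
   last, whence the bound on [a]. *)
Definition marked t w (a : 'I_m.+2) :=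
  (a < m.+1)%N && ((eps <= fa t a w) || (eps <= fb t a w)).

(** The sign tells which distribution is heavy at the colour. By [marked_exists] the default does
    not occur for [t <= L]. *)
Definition lab t w : label :=
  if [pick a | marked t w a] is Some a then (val a, eps <= fa t a w)
  else (0%N, true).

Lemma eps_gt0 : 0 < eps.
Proof. by rewrite invr_gt0 ltr0n. Qed.

Lemma exists_big (f : 'I_m.+2 -> R) : \sum_a f a = 1 -> exists a, eps <= f a.
Proof.
move=> f1; apply: contrapT => H.
have : \sum_a f a < \sum_(a < m.+2) eps.
  apply: ltr_sum => [|a _]; first by apply/hasP; exists ord0; rewrite ?mem_index_enum.
  by rewrite ltNge; apply/negP => fa'; apply: H; exists a.
by rewrite f1 sumr_const card_ord -(mulr_natr eps m.+2) mulVf ?pnatr_eq0 // ltxx.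
Qed.

(* A colour cannot be heavy for both distributions, so at least one of the two
   heavy colours is not the discarded last one. *)
Lemma marked_exists t w : (t <= L)%N -> exists a, marked t w a.
Proof.
move=> tL; have [a ha] := exists_big (fa_sum t w).
have [b hb] := exists_big (fb_sum t w).
have ab : a != b.
  apply/eqP => e; subst b; apply: (@fafb t t a w) => //.
    by apply: lt_le_trans ha; exact: eps_gt0.
  by apply: lt_le_trans hb; exact: eps_gt0.
case: (ltnP a m.+1) => am; first by exists a; rewrite /marked am ha.
exists b; rewrite /marked hb orbT andbT.
move: ab (ltn_ord a) (ltn_ord b); rewrite -val_eqE /=; lia.
Qed.

Lemma labP t w : (t <= L)%N -> exists a : 'I_m.+2,
  [/\ (lab t w).1 = a, (a < m.+1)%N &
      if (lab t w).2 then eps <= fa t a w else eps <= fb t a w].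
Proof.
move=> tL; rewrite /lab; case: pickP => [a /andP[am hab]|none]; last first.
  by have [a] := marked_exists w tL; rewrite none.
by exists a; split => //=; case: ifP hab => //= ->.
Qed.

Lemma lab_even w : lab 0 (gam w) = lab 0 w.
Proof.
rewrite /lab; under eq_pick => a do rewrite /marked fa_even fb_even.
by case: pickP => [a _|]; rewrite ?fa_even.
Qed.

(** At time [L] the involution exchanges [fa] and [fb]. Being marked is symmetric in them, so the
    same colour is picked; its sign changes because it cannot be heavy for both. *)
Lemma lab_odd w : lab L (gam w) = neg (lab L w).
Proof.
have [a0 ma0] := marked_exists w (leqnn L).
rewrite /lab; under eq_pick => a do rewrite /marked fa_odd fb_odd orbC.
case: pickP => [a /andP[am hab]|none]; last first.
  by have := none a0; rewrite -/(marked _ _ _) ma0.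
rewrite fa_odd /neg /=; congr pair.
case: (boolP (eps <= fa L a w)) hab => [ha _|_ /= ->//].
apply/negP => hb; apply: (@fafb L L a w) => //.
  by apply: lt_le_trans ha; exact: eps_gt0.
by apply: lt_le_trans hb; exact: eps_gt0.
Qed.

(** Opposite labels yield one colour that is heavy for [fa] at one point and for [fb] at the other.
    As [fa] varies by less than the threshold, both are positive at a common point, against
    [fafb]. *)
Lemma lab_compatible t t' w w' : (t <= L)%N -> (t' <= L)%N ->
  (t <= t'.+1)%N -> (t' <= t.+1)%N ->
  (forall s a, (s <= L)%N -> `|fa s a w - fa s a w'| < eps) ->
  lab t w <> neg (lab t' w').
Proof.
move=> tL t'L tt' t't ww' E.
have [a [ea _ ha]] := labP w tL; have [b [eb _ hb]] := labP w' t'L.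
have ab : a = b by apply/val_inj; rewrite /= -ea -eb E.
subst b; move: ha hb; rewrite E /neg /=; case: (lab t' w').2 => /= ha hb.
  apply: (@fafb t' t a w) => //; last by apply: lt_le_trans ha; exact: eps_gt0.
  by move: (ww' t' a t'L) hb; move: eps => e; rewrite ltr_norml => /andP[]; lra.
apply: (@fafb t t' a w') => //; last by apply: lt_le_trans hb; exact: eps_gt0.
by move: (ww' t a tL) ha; move: eps => e; rewrite ltr_norml => /andP[]; lra.
Qed.

(** * Grid points of the cube *)

Section Grid.
Variable N : nat.
Hypothesis N_gt0 : (0 < N)%N.

Definition gridpt j (z : pt) : 'rV[R]_j := \row_i ((z i)%:R / N%:R).

Lemma N_neq0 : (N%:R : R) != 0.
Proof. by rewrite pnatr_eq0 -lt0n. Qed.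

Lemma gridpt_cube j z : bounded N z -> cube (gridpt j z).
Proof.
move=> bz i; rewrite mxE divr_ge0 //= ler_pdivrMr ?ltr0n // mul1r ler_nat.
exact: bz.
Qed.

Lemma gridpt_boundary j z i : bounded N z -> (i < j)%N ->
  z i = 0 \/ z i = N -> cube_boundary (gridpt j z).
Proof.
move=> bz ij zi; split; first exact: gridpt_cube.
exists (Ordinal ij); rewrite mxE /=.
by case: zi => ->; [left; rewrite mul0r | right; rewrite mulfV ?N_neq0].
Qed.

Lemma gridpt_anti j z : bounded N z -> gridpt j (anti N j z) = antipode (gridpt j z).
Proof.
move=> bz; apply/rowP => i; rewrite antipodeE !mxE antiE ltn_ord.
by rewrite natrB // mulrBl mulfV ?N_neq0.
Qed.

Lemma gridpt_upd j z k : gridpt j (upd z j k) = gridpt j z.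
Proof. by apply/rowP => i; rewrite !mxE updE ltn_eqF. Qed.

Lemma init_gridpt j z : init_coords (gridpt j.+1 z) = gridpt j z.
Proof. by apply/rowP => i; rewrite !mxE. Qed.

Lemma last_gridpt j z : last_coord (gridpt j.+1 z) = (z j)%:R / N%:R.
Proof. by rewrite /last_coord mxE. Qed.

Lemma gridpt_near j (v w : pt) (d : R) : N%:R^-1 < d -> near_pt v w ->
  `|gridpt j v - gridpt j w| < d.
Proof.
move=> Nd vw; rewrite /Num.norm /= mx_normrE.
have d0 : 0 < d by apply: le_lt_trans Nd; rewrite invr_ge0.
apply/bigmax_ltP; split => // -[i k] _ /=; apply: le_lt_trans Nd.
rewrite !mxE -mulrBl normrM (@ger0_norm _ N%:R^-1) ?invr_ge0 //.
rewrite ler_piMl ?invr_ge0 //; have [vw1 vw2] := vw k.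
have : (v k)%:R <= (w k).+1%:R :> R by rewrite ler_nat.
have : (w k)%:R <= (v k).+1%:R :> R by rewrite ler_nat.
by rewrite -!natr1 ler_norml => *; apply/andP; split; lra.
Qed.

End Grid.

Lemma no_levels (x0 : X) :
  (forall j (x1 : X), (j < m)%N -> trivial_homotopy_group R j x1) -> False.
Proof.
move=> triv; have [h [ah hh]] := antipodal_tower cgam gamK x0 triv.
have [d [d0 hd gd]] : exists d : R, [/\ 0 < d,
    forall j s a x y, (j <= m)%N -> (s <= L)%N -> cube x -> `|x - y| < d ->
      `|fa s a (h j x) - fa s a (h j y)| < eps &
    forall s a x y, (s <= L)%N -> cube x -> `|x - y| < d ->
      `|fa s a (gam (h m x)) - fa s a (gam (h m y))| < eps].
  have H1 : \forall d \near 0^'+, forall i : 'I_m.+1 * 'I_L.+1 * 'I_m.+2,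
      forall x y : 'rV[R]_i.1.1, cube x -> `|x - y| < d ->
      `|fa i.1.2 i.2 (h i.1.1 x) - fa i.1.2 i.2 (h i.1.1 y)| < eps.
    apply: filter_forall => -[[j s] a] /=.
    apply: (cube_uniform (f := fun x => fa s a (h j x))); last exact: eps_gt0.
    apply: continuous_compT; first exact: cfa.
    by have [] := ah j (ltn_ord j).
  have H2 : \forall d \near 0^'+, forall i : 'I_L.+1 * 'I_m.+2,
      forall x y : 'rV[R]_m, cube x -> `|x - y| < d ->
      `|fa i.1 i.2 (gam (h m x)) - fa i.1 i.2 (gam (h m y))| < eps.
    apply: filter_forall => -[s a] /=.
    apply: (cube_uniform (f := fun x => fa s a (gam (h m x)))); last exact: eps_gt0.
    apply: continuous_compT; first exact: cfa.
    by apply: continuous_compT => //; have [] := ah m (leqnn m).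
  have H3 : \forall d \near 0^'+, 0 < d :> R by exact: nbhs_right_gt.
  have [d [[h1 h2] h3]] := @filter_ex _ _ _ _ (filterI (filterI H1 H2) H3).
  exists d; split => // [j s a x y jm sL|s a x y sL].
    exact: (h1 (Ordinal (jm : (j < m.+1)%N), Ordinal (sL : (s < L.+1)%N), a)).
  exact: (h2 (Ordinal (sL : (s < L.+1)%N), a)).
(* The mesh must be finer than [d], and time must have room to reach [L]. *)
pose N := maxn (Num.truncn d^-1).+1 L.
have N0 : (0 < N)%N by rewrite leq_max.
have NL : (L <= N)%N by exact: leq_maxr.
have Nd : N%:R^-1 < d.
  rewrite -[d]invrK ltf_pV2 ?posrE ?ltr0n ?invr_gt0 //.
  apply: lt_le_trans (truncnS_gt _) _; by rewrite ler_nat leq_maxl.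
pose gp j z := gridpt N j z.
(* The labels are pulled back along the tower; in [U] and [W] the last coordinate is the time,
   stopped at [L]. *)
pose La j z := lab L (h j (gp j z)).
pose U z := lab (minn (z m) L) (h m (gp m z)).
pose W z := lab (minn (z m) L) (gam (h m (gp m (anti N m z)))).
have banti j z : bounded N z -> bounded N (anti N j z).
  by move=> bz i; rewrite antiE; case: ifP => // _; exact: leq_subr.
apply: (@no_odd_even_homotopy N m La U W).
- move=> j jm v w bv bw vw; apply: lab_compatible => // s a sL.
  by apply: hd => //; [exact: gridpt_cube | exact: gridpt_near].
- by move=> j z k; rewrite /La /gp gridpt_upd.
- move=> j z jm bz zj; rewrite /La; have [h1 _ _] := hh j jm.
  rewrite h1 ?init_gridpt //; first exact: gridpt_cube.
  by rewrite last_gridpt zj mulfV ?N_neq0.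
- move=> j z jm bz zj; rewrite /La; have [_ h0 _] := hh j jm.
  rewrite h0 ?init_gridpt; [|exact: gridpt_cube|by rewrite last_gridpt zj mul0r].
  by rewrite lab_odd /gp gridpt_anti.
- move=> j i z jm bz ij zi zj; rewrite /La; have [_ _ hb] := hh j jm.
  have bz' : bounded N (step z j) by exact: bounded_upd.
  have bd := gridpt_boundary N0 bz ij zi.
  rewrite !hb ?init_gridpt /step ?gridpt_upd //; exact: gridpt_cube.
- move=> v w bv bw vw; have [vw1 vw2] := vw m.
  apply: lab_compatible; rewrite ?geq_minr //; [lia|lia|] => s a sL.
  by apply: hd => //; [exact: gridpt_cube | exact: gridpt_near].
- move=> v w bv bw vw; have [vw1 vw2] := vw m.
  apply: lab_compatible; rewrite ?geq_minr //; [lia|lia|] => s a sL.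
  apply: gd => //; first by apply: gridpt_cube => //; exact: banti.
  apply: gridpt_near => // i; rewrite !antiE; case: ifP => // _.
  have [? ?] := vw i; lia.
- move=> z bz; have [a [-> //]] := labP (h m (gp m z)) (geq_minr (z m) L).
- by move=> z bz; have [a [-> //]] := labP (gam (h m (gp m (anti N m z)))) (geq_minr (z m) L).
- move=> i z bz im zi; rewrite /U /W /gp gridpt_anti //.
  have [_ ->] := ah m (leqnn m); first by rewrite gamK.
  exact: gridpt_boundary im zi.
- by move=> z bz zm; rewrite /U /La zm (minn_idPr NL).
- by move=> z bz zm; rewrite /W /La zm (minn_idPr NL) lab_odd.
- move=> z bz zm; rewrite /W /U antiE ltnn zm min0n lab_even //.
Qed.

End Levels.

(** * Colour distributions on the Hom complex *)

Section Weights.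
Variables (R : realType) (d : Order.disp_t) (P : porderType d).
Local Notation X := (realization R P).
Implicit Types (w : X) (phi : P -> R).

Lemma realization_eq w w' : Defs.coord w = Defs.coord w' -> w = w'.
Proof.
case: w w' => [f f0 fc fs] [g g0 gc gs] /= fg; subst g.
by congr Realization; exact: Prop_irrelevance.
Qed.

(** The extension of [phi] from the vertices, affine on each simplex. *)
Definition weight phi w : R := \sum_(x \in [set: P]) w x * phi x.

Lemma weightE phi w (C : {fset P}) :
  (forall x, w x != 0 -> x \in C) -> weight phi w = \sum_(x <- C) w x * phi x.
Proof.
move=> wC; apply: fsbigTE => x; apply: contraNeq => wx.
by apply: wC; apply: contraNneq wx => ->; rewrite mul0r.
Qed.

Definition supp w : {fset P} := fset_set [set x | Defs.coord w x != 0].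

Lemma in_supp w x : (x \in supp w) = (w x != 0).
Proof.
rewrite in_fset_set; last by have [] := coord_chain w.
by apply/idP/idP => [/set_mem|wx]; last exact: mem_set.
Qed.

Lemma weight_supp phi w : weight phi w = \sum_(x <- supp w) w x * phi x.
Proof. by apply: weightE => x; rewrite in_supp. Qed.

Lemma sum_supp w : \sum_(x <- supp w) w x = 1.
Proof.
rewrite -(coord_sum w); apply/esym/fsbigTE => x.
by rewrite in_supp negbK => /eqP.
Qed.

Lemma weight_sum (I : finType) (phi : I -> P -> R) w :
  (forall x, \sum_i phi i x = 1) -> \sum_i weight (phi i) w = 1.
Proof.
move=> phi1; rewrite -(sum_supp w).
under eq_bigr do rewrite weight_supp.
rewrite exchange_big /=; apply: eq_bigr => x _.
by rewrite -mulr_sumr phi1 mulr1.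
Qed.

Lemma weight_ge0 phi w : (forall x, 0 <= phi x) -> 0 <= weight phi w.
Proof.
move=> phi0; rewrite weight_supp; apply: sumr_ge0 => x _.
by rewrite mulr_ge0 // coord_ge0.
Qed.

Lemma weight_neq0 phi w : weight phi w != 0 -> exists2 x, w x != 0 & phi x != 0.
Proof.
move=> w0; apply: contrapT => H; move/eqP: w0; apply.
rewrite weight_supp big_seq big1 // => x; rewrite in_supp => wx.
by case: (eqVneq (phi x) 0) => [->|px]; rewrite ?mulr0 //; case: H; exists x.
Qed.

(** On a closed simplex with [N] vertices the extension is [N]-Lipschitz for the sup metric. *)
Lemma continuous_weight phi : (forall x, `|phi x| <= 1) -> continuous (weight phi).
Proof.
move=> phi1 w A /nbhs_ballP[e /= e0 eA].
exists [set w' | `|weight phi w - weight phi w'| < e]; split; last 2 first.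
- by rewrite /= subrr normr0.
- by move=> w' /= we; apply: eA; rewrite -ball_normE.
move=> C [fC _] w1 Cw1 /= we.
pose N := size (fset_set C); pose e1 := e - `|weight phi w - weight phi w1|.
have e10 : 0 < e1 by rewrite subr_gt0.
exists (e1 / N.+1%:R) => [|w2 Cw2 w12]; first by rewrite divr_gt0.
have inC (v : X) : closed_simplex C v -> forall x, v x != 0 -> x \in fset_set C.
  by move=> Cv x vx; rewrite in_fset_set //; apply: mem_set; exact: Cv.
suff H : `|weight phi w1 - weight phi w2| < e1.
  have -> : weight phi w - weight phi w2 =
    (weight phi w - weight phi w1) + (weight phi w1 - weight phi w2) by ring.
  apply: le_lt_trans (ler_normD _ _) _; rewrite -ltrBrDl //.
rewrite (weightE phi (inC _ Cw1)) (weightE phi (inC _ Cw2)) -sumrB.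
apply: le_lt_trans (ler_norm_sum _ _ _) _.
have : \sum_(x <- fset_set C) `|w1 x * phi x - w2 x * phi x| <=
       \sum_(x <- fset_set C) e1 / N.+1%:R.
  apply: ler_sum => x _; rewrite -mulrBl normrM; apply: le_trans (ltW (w12 x)).
  by rewrite ler_piMr.
move/le_lt_trans; apply.
rewrite big_const_seq count_predT iter_addr_0 -/N -[_ *+ N]mulr_natr -mulrA.
by rewrite gtr_pMr // mulrC ltr_pdivrMr // mul1r ltr_nat.
Qed.

Variable sg : P -> P.
Hypotheses (sgK : involutive sg) (sg_le : {homo sg : x y / (x <= y)%O}).

Lemma flip_chain C : finite_chain C -> finite_chain [set x | C (sg x)].
Proof.
move=> [fC cC]; split.
  have -> : [set x | C (sg x)] = sg @` C; last exact: finite_image.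
  apply/seteqP; split => x /=; first by exists (sg x).
  by move=> [y Cy <-]; rewrite sgK.
move=> x y /= Cx Cy; have := cC _ _ Cx Cy; rewrite /Order.comparable.
by move=> /orP[/sg_le|/sg_le]; rewrite !sgK => ->; rewrite ?orbT.
Qed.

Lemma flip_sum w : \sum_(x \in [set: P]) w (sg x) = 1.
Proof.
rewrite -(coord_sum w) [RHS](reindex_fsbig sg setT) //.
split => // [x y _ _|y _]; first exact: (can_inj sgK).
by exists (sg y).
Qed.

(** As [sg] is an involution, pulling coordinates back along it is the same as pushing points
    forward. *)
Definition realization_flip w : X :=
  Realization (fun x => coord_ge0 w (sg x)) (flip_chain (coord_chain w)) (flip_sum w).

Lemma realization_flipK : involutive realization_flip.
Proof. by move=> w; apply: realization_eq; apply/funext => x /=; rewrite sgK. Qed.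

Lemma continuous_realization_flip : continuous realization_flip.
Proof.
move=> w A [B [oB Bw BA]]; exists (realization_flip @^-1` B); split => //; last first.
  by move=> w'; exact: BA.
move=> C cC w1 Cw1 Bw1.
have [|e e0 eB] := oB _ (flip_chain cC) (realization_flip w1) _ Bw1; first by move=> x /Cw1.
exists e => // w2 Cw2 w12; apply: eB; first by move=> x /Cw2.
by move=> x; exact: w12.
Qed.

Lemma weight_realization_flip phi w : weight phi (realization_flip w) = weight (phi \o sg) w.
Proof.
rewrite /weight [LHS](reindex_fsbig sg setT) .
  by apply: eq_fsbigr => x _ /=; rewrite sgK.
split => // [x y _ _|y _]; first exact: (can_inj sgK).
by exists (sg y).
Qed.

End Weights.

(** * The reflection and the colour distributions *)

Section Reflection.
Variables (r : nat) (G : graph).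
Local Notation C := (odd_cycle r).
Local Notation cell := (hom_cell C G).

Lemma opp_edge (x y : C) : edge x y -> @edge C (- x) (- y).
Proof. by case=> ->; [right | left]; rewrite opprD subrK. Qed.

Definition reflect_cell (e : cell) : cell :=
  @HomCell C G (fun x => e (- x)) (fun x => cell_neq0 e (- x))
    (fun x y xy => cell_edge (opp_edge xy)).

Lemma reflect_cellK : involutive reflect_cell.
Proof. by move=> e; apply: hom_cell_inj; apply/funext => x /=; rewrite opprK. Qed.

Lemma reflect_cell_le : {homo reflect_cell : x y / (x <= y)%O}.
Proof. by move=> a b /asboolP ab; apply/asboolP => x; exact: ab. Qed.

Definition pick_in (A : set G) (A0 : A !=set0) : G := projT1 (cid A0).

Lemma pick_inP A A0 : A (@pick_in A A0).
Proof. exact: projT2 (cid A0). Qed.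

Variables (R : realType) (n : nat) (c : G -> 'I_n).
Hypothesis c_proper : forall x y, edge x y -> c x != c y.

Definition colour_at (i : C) (a : 'I_n) (e : cell) : R :=
  (c (pick_in (cell_neq0 e i)) == a)%:R.

Definition colour_weight i a : realization R cell -> R := weight (colour_at i a).

Definition gam : realization R cell -> realization R cell :=
  realization_flip (@reflect_cellK) (@reflect_cell_le).

Lemma colour_weight_ge0 i a w : 0 <= colour_weight i a w.
Proof. by apply: weight_ge0 => e; exact: ler0n. Qed.

Lemma colour_weight_sum i w : \sum_a colour_weight i a w = 1.
Proof.
apply: weight_sum => e; rewrite /colour_at.
rewrite (bigD1 (c (pick_in (cell_neq0 e i)))) //= eqxx big1 ?addr0 // => a.
by rewrite eq_sym => /negPf->.
Qed.

Lemma continuous_colour_weight i a : continuous (colour_weight i a).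
Proof.
apply: continuous_weight => e; rewrite /colour_at.
by case: eqP; rewrite ?normr1 ?normr0 // ler01.
Qed.

(** [reflect_cell] reuses the nonemptiness proofs of the given cell, so the chosen elements agree by
    computation. *)
Lemma colour_weight_gam i a w : colour_weight i a (gam w) = colour_weight (- i) a w.
Proof. by rewrite /colour_weight /gam weight_realization_flip. Qed.

(** Cells in the support of [w] are comparable, so both chosen elements lie in the larger one, which
    makes them adjacent in [G]. *)
Lemma colour_weight_disjoint (i j : C) a w : edge i j ->
  0 < colour_weight i a w -> 0 < colour_weight j a w -> False.
Proof.
move=> ij /lt0r_neq0 /weight_neq0[e we +] /lt0r_neq0 /weight_neq0[f wf].
rewrite /colour_at !pnatr_eq0 !eqb0 !negbK => /eqP ea /eqP fa.
pose x := pick_in (cell_neq0 e i); pose y := pick_in (cell_neq0 f j).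
have ex : e i x by exact: pick_inP.
have fy : f j y by exact: pick_inP.
suff xy : edge x y by have := c_proper xy; rewrite /x /y ea fa eqxx.
have [_ /(_ e f we wf)] := coord_chain w.
case/orP => /asboolP le.
  exact: (cell_edge (h := f) ij (le i x ex) fy).
exact: (cell_edge (h := e) ij ex (le j y fy)).
Qed.

End Reflection.

(** * Moving the two vertices along the cycle *)

Section ColourLevels.
Variables (r : nat) (G : graph) (R : realType) (m : nat) (c : G -> 'I_m.+2).
Hypothesis r_gt0 : (1 <= r)%N.
Hypothesis c_proper : forall x y, edge x y -> c x != c y.
Local Notation C := (odd_cycle r).
Local Notation X := (realization R (hom_cell C G)).
Local Notation A t := (@colour_weight r G R m.+2 c (t%:R : 'Z_(2 * r + 1))).

(* At time [t > 0] the vertices [t - 1] and [t] are used, the even one first. *)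
Definition level_pos (t : nat) (a : 'I_m.+2) (w : X) : R :=
  if t is s.+1 then (if odd t then A s a w else A t a w) else A 0%N a w.

(* [A (2 * r)] is the weight at the vertex [-1]. *)
Definition level_neg (t : nat) (a : 'I_m.+2) (w : X) : R :=
  if t is s.+1 then (if odd t then A t a w else A s a w)
  else (A 1%N a w + A (2 * r)%N a w) / 2.

Lemma two_r_lt : (1 < 2 * r + 1)%N.
Proof. lia. Qed.

Lemma oppr_nat t : (t <= 2 * r + 1)%N ->
  - (t%:R : 'Z_(2 * r + 1)) = (2 * r + 1 - t)%:R.
Proof.
move=> tr; rewrite natrB //.
have -> : (2 * r + 1)%:R = 0 :> 'Z_(2 * r + 1) by exact: (pchar_Zp two_r_lt).
by rewrite sub0r.
Qed.

Lemma nat_edge t : @edge C (t%:R : 'Z_(2 * r + 1)) (t.+1%:R : 'Z_(2 * r + 1)).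
Proof. by left; rewrite -natr1. Qed.

Lemma last_edge : @edge C (0 : 'Z_(2 * r + 1)) ((2 * r)%:R : 'Z_(2 * r + 1)).
Proof.
right; have := oppr_nat (leqnn (2 * r + 1)); rewrite subnn natrD => /eqP.
by rewrite oppr_eq0 => /eqP->.
Qed.

Lemma no_coloring (x0 : X) :
  (forall j (x1 : X), (j < m)%N -> trivial_homotopy_group R j x1) -> False.
Proof.
(* The last time is [r.+1]: it uses the vertices [r] and [r.+1], which the reflection exchanges. *)
apply: (@no_levels R X (@gam r G R) m r.+1 level_pos level_neg) => //.
- exact: continuous_realization_flip.
- exact: realization_flipK.
- by case=> [|s] a; rewrite /level_pos; [|case: (odd s.+1)];
    exact: continuous_colour_weight.
- by case=> [|s] w; rewrite /level_pos; [|case: (odd s.+1)];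
    exact: colour_weight_sum.
- case=> [|s] w; rewrite /level_neg.
    by rewrite -mulr_suml big_split /= !colour_weight_sum; lra.
  by case: (odd s.+1); exact: colour_weight_sum.
- have E t a w : 0 < A t a w -> 0 < A t.+1 a w -> False.
    exact: (colour_weight_disjoint c_proper (nat_edge t)).
  have E0 a w : 0 < A 0%N a w -> 0 < (A 1%N a w + A (2 * r)%N a w) / 2 -> False.
    move=> h0 h1; have [h|h] : 0 < A 1%N a w \/ 0 < A (2 * r)%N a w.
    + have := colour_weight_ge0 c (1%:R : 'Z_(2 * r + 1)) a w.
      rewrite le_eqVlt => /orP[/eqP e|]; last by left.
      by right; rewrite -e in h1; lra.
    + exact: (E _ _ _ h0 h).
    + exact: (colour_weight_disjoint c_proper last_edge h0 h).
  (* At positive times [level_pos] uses the even and [level_neg] the odd one of two consecutive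
     numbers, so at times differing by at most one the two vertices compared are adjacent. *)
  move=> t t' a w _ _ tt' t't.
  have : t' = t \/ t' = t.+1 \/ t = t'.+1 by lia.
  case=> [->|[->|->]].
  + case: (t) => [|s] /=; first exact: E0.
    by case: ifP => _ p q; [exact: (E _ _ _ p q) | exact: (E _ _ _ q p)].
  + case: (t) => [|s] /=; first exact: E.
    by case: (odd s) => /= p q; exact: (E _ _ _ p q).
  + case: (t') => [|s] /=; first exact: E0.
    by case: (odd s) => /= p q; exact: (E _ _ _ q p).
- by move=> a w; rewrite /level_pos colour_weight_gam mulr0n oppr0.
- have e1 : - (1%:R : 'Z_(2 * r + 1)) = (2 * r)%:R.
    by rewrite oppr_nat; [congr _%:R; lia | lia].
  have e2 : - ((2 * r)%:R : 'Z_(2 * r + 1)) = 1%:R by rewrite -e1 opprK.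
  by move=> a w; rewrite /level_neg !colour_weight_gam e1 e2 addrC.
- have er : - (r%:R : 'Z_(2 * r + 1)) = r.+1%:R.
    by rewrite oppr_nat; [congr _%:R; lia | lia].
  have er' : - (r.+1%:R : 'Z_(2 * r + 1)) = r%:R by rewrite -er opprK.
  by move=> a w; rewrite /level_pos /level_neg /=; case: (odd r) => /=;
    rewrite colour_weight_gam ?er ?er'.
- have er : - (r%:R : 'Z_(2 * r + 1)) = r.+1%:R.
    by rewrite oppr_nat; [congr _%:R; lia | lia].
  have er' : - (r.+1%:R : 'Z_(2 * r + 1)) = r%:R by rewrite -er opprK.
  by move=> a w; rewrite /level_pos /level_neg /=; case: (odd r) => /=;
    rewrite colour_weight_gam ?er ?er'.
Qed.

End ColourLevels.

(** * The bound on the chromatic number *)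

Theorem theorem1p3 (R : realType) (G : graph) (r : nat) (k : int)
    (hr : (1 <= r)%N) (hk : -1 <= k)
    (hconn : k_connected R (Hom_complex R (odd_cycle r) G) k) :
  (((k + 4)%:~R)%:E <= chromatic_number R G)%E.
Proof.
apply: le_ereal_inf_tmp => _ [n [c c_proper] <-].
rewrite lee_fin -[n%:R]/(n%:Z%:~R) ler_int leNgt; apply/negP => nk.
have [[x0 _] triv] := hconn.
(* A point of the complex yields a cell, hence an edge of [G], which excludes fewer than two
   colours. *)
have [e we] : exists e, x0 e != 0.
  apply: contrapT => H; have := sum_supp x0; rewrite big_seq big1.
    by move/esym/eqP; rewrite oner_eq0.
  by move=> e; rewrite in_supp => we; case: H; exists e.
have [x ex] := cell_neq0 e 0; have [y ey] := cell_neq0 e 1.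
have xy : edge x y by apply: (cell_edge (h := e) _ ex ey); left; rewrite add0r.
case: n c c_proper nk => [|[|m]] c c_proper nk.
- by case: (c x).
- by have := c_proper _ _ xy; rewrite !ord1.
(* From [m + 2 < k + 4] every [j < m] satisfies [j <= k]. *)
- apply: (@no_coloring r G R m c hr c_proper x0) => j x1 jm.
  by apply: triv; lia.
Qed.
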